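(* Let $(M^{2m},g)$ be a Kähler manifold of complex dimension $m\ge 2$ (real dimension $n=2m$). If $M$ has four-nonnegative curvature operator of the second kind, then $M$ is flat.
   Context: Curvature operator of the second kind: let $(V,g)$ be a Euclidean vector space of (real) dimension $n$ with orthonormal basis $\{e_1,\dots,e_n\}$, and let $R$ be an algebraic curvature operator on $V$, i.e. a 4-tensor $R_{ijkl}=R(e_i,e_j,e_k,e_l)$ with the symmetries of a Riemann curvature tensor, including the first Bianchi identity. The sign convention is that the sectional curvature of the plane spanned by $e_i,e_j$ ($i\neq j$) is $R_{ijij}$; the unit sphere has $R_{ijkl}=g_{ik}g_{jl}-g_{il}g_{jk}$. Let $S^2_0(V)$ be the space of traceless symmetric two-tensors on $V$, with inner product $\langle A,B\rangle=\mathrm{tr}(A^TB)$; its dimension is $N=\frac{(n-1)(n+2)}{2}$. The curvature operator of the second kind of $R$ is the symmetric bilinear form $\mathring{R}(\varphi,\psi)=\sum_{i,j,k,l=1}^n R_{ijkl}\varphi_{il}\psi_{jk}$ on $S^2_0(V)$. Its eigenvalues are those of the $N\times N$ matrix $(\mathring{R}(\varphi_a,\varphi_b))$ for any orthonormal basis $\{\varphi_a\}$ of $S^2_0(V)$. For an integer $1\le k\le N$, $R$ has $k$-nonnegative curvature operator of the second kind if the sum of the $k$ smallest eigenvalues (with multiplicity) of $\mathring{R}$ is nonnegative. A Riemannian manifold has this property if its Riemann curvature tensor $R_p$ on $V=T_pM$ (the real tangent space) has it for every point $p$. *)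

(* Defs.v *)
From HB Require Import structures.
From mathcomp Require Import all_boot all_order all_algebra.
From mathcomp Require Import all_classical all_reals all_analysis.

Set Implicit Arguments.
Unset Strict Implicit.
Unset Printing Implicit Defensive.

Import Order.TTheory GRing.Theory Num.Theory.
Import numFieldNormedType.Exports.

Local Open Scope classical_set_scope.
Local Open Scope ring_scope.

Section AlgebraicCurvature.
Variables (R : realType) (n : nat).

(* Components R_{ijkl} = T i j k l of a 4-tensor in an orthonormal basis of a
   Euclidean vector space; a symmetric two-tensor is given by its matrix in the
   same basis. *)
Definition tensor4 := 'I_n -> 'I_n -> 'I_n -> 'I_n -> R.

Definition curv_op2 (T : tensor4) (A B : 'M[R]_n) : R :=
  \sum_i \sum_j \sum_k \sum_l T i j k l * A i l * B j k.

Definition traceless_sym (A : 'M[R]_n) : Prop := A^T = A /\ \tr A = 0.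

Definition S20_orthonormal_basis (N : nat) (phi : 'I_N -> 'M[R]_n) : Prop :=
  [/\ forall a, traceless_sym (phi a),
      forall a b, \tr ((phi a)^T *m phi b) = (a == b)%:R
    & forall A, traceless_sym A ->
        exists c : 'I_N -> R, A = \sum_a c a *: phi a].

Definition curv_op2_mx (T : tensor4) (N : nat) (phi : 'I_N -> 'M[R]_n) :
    'M[R]_N :=
  \matrix_(a, b) curv_op2 T (phi a) (phi b).

(* The eigenvalues of A with multiplicity, in nondecreasing order. *)
Definition ordered_eigenvalues (N : nat) (A : 'M[R]_N) (s : seq R) : Prop :=
  sorted <=%R s /\ char_poly A = \prod_(l <- s) ('X - l%:P).

(* For 1 <= k <= N; the size N of an orthonormal basis of S^2_0 is necessarily
   (n - 1)(n + 2)/2. *)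
Definition k_nonneg_curv_op2 (k : nat) (T : tensor4) : Prop :=
  forall (N : nat) (phi : 'I_N -> 'M[R]_n), S20_orthonormal_basis phi ->
    exists2 s : seq R, ordered_eigenvalues (curv_op2_mx T phi) s
                     & 0 <= \sum_(l <- take k s) l.

End AlgebraicCurvature.

Section LocalCoordinates.
Variables (R : realType) (n : nat).
Local Notation E := 'rV[R]_n.

Definition pderiv (i : 'I_n) (f : E -> R) : E -> R :=
  fun x => 'D_(delta_mx 0 i) f x.

(* f is C^oo on the open set U: all iterated partial derivatives are
   (Frechet) differentiable at every point of U. *)
Definition smooth_on (U : set E) (f : E -> R) : Prop :=
  forall (s : seq 'I_n) (x : E), U x -> differentiable (foldr pderiv f s) x.

Definition smooth_map_on (U : set E) (f : E -> E) : Prop :=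
  forall i : 'I_n, smooth_on U (fun x => f x 0 i).

Definition gram (G : 'M[R]_n) (v w : E) : R := (v *m G *m w^T) 0 0.

Variable g : E -> 'M[R]_n.

(* christoffel k i j = Gamma^k_{ij} *)
Definition christoffel (k i j : 'I_n) (x : E) : R :=
  2^-1 * \sum_l invmx (g x) k l *
    (pderiv i (fun y => g y j l) x + pderiv j (fun y => g y i l) x
     - pderiv l (fun y => g y i j) x).

(* Coefficient of d_l in R(d_i, d_j) d_k, where
   R(X, Y) Z = nabla_X nabla_Y Z - nabla_Y nabla_X Z - nabla_[X, Y] Z. *)
Definition curv_endo (x : E) (i j k l : 'I_n) : R :=
  pderiv i (christoffel l j k) x - pderiv j (christoffel l i k) x
  + \sum_s (christoffel l i s x * christoffel s j k x
            - christoffel l j s x * christoffel s i k x).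

(* R_{ijkl} = g(R(d_i, d_j) d_l, d_k), so that R_{ijij} is the sectional
   curvature for an orthonormal pair. *)
Definition riemann (x : E) : tensor4 R n :=
  fun i j k l => \sum_s curv_endo x i j l s * g x s k.

(* The rows of B are the vectors of the frame. *)
Definition orthonormal_frame (x : E) (B : 'M[R]_n) : Prop :=
  B *m g x *m B^T = 1%:M.

Definition riemann_in_frame (x : E) (B : 'M[R]_n) : tensor4 R n :=
  fun a b c d => \sum_i \sum_j \sum_k \sum_l
    riemann x i j k l * B a i * B b j * B c k * B d l.

End LocalCoordinates.

(* An n-dimensional Riemannian manifold: a second countable Hausdorff space
   with a smooth atlas (chart i is a homeomorphism from the open set dom i onto
   an open subset of R^n, with inverse param i) and a metric given by its
   coordinate matrices, which transform as a (0,2)-tensor. *)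
Record riemannianManifold (R : realType) (n : nat) := RiemannianManifold {
  carrier : topologicalType;
  chart_index : Type;
  dom : chart_index -> set carrier;
  chart : chart_index -> carrier -> 'rV[R]_n;
  param : chart_index -> 'rV[R]_n -> carrier;
  metric : chart_index -> 'rV[R]_n -> 'M[R]_n;
  carrier_hausdorff : hausdorff_space carrier;
  carrier_second_countable : @second_countable carrier;
  dom_open : forall i, open (dom i);
  dom_cover : forall p, exists i, dom i p;
  chart_open : forall i, open (chart i @` dom i);
  chartK : forall i p, dom i p -> param i (chart i p) = p;
  chart_continuous : forall i, {within dom i, continuous (chart i)};
  param_continuous : forall i,
    {within chart i @` dom i, continuous (param i)};
  transition_smooth : forall i j,
    smooth_map_on (chart i @` (dom i `&` dom j)) (chart j \o param i);
  metric_smooth : forall i a b,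
    smooth_on (chart i @` dom i) (fun x => metric i x a b);
  metric_sym : forall i p, dom i p ->
    (metric i (chart i p))^T = metric i (chart i p);
  metric_pos : forall i p (v : 'rV[R]_n), dom i p -> v != 0 ->
    0 < gram (metric i (chart i p)) v v;
  metric_transition : forall i j p (v w : 'rV[R]_n), dom i p -> dom j p ->
    gram (metric i (chart i p)) v w =
    gram (metric j (chart j p))
      ('d (chart j \o param i) (chart i p) v)
      ('d (chart j \o param i) (chart i p) w)
}.

Definition k_nonneg_curvature_second_kind (R : realType) (n : nat) (k : nat)
    (M : riemannianManifold R n) : Prop :=
  forall (p : carrier M) (i : chart_index M) (B : 'M[R]_n), dom i p ->
    orthonormal_frame (metric i) (chart i p) B ->
    k_nonneg_curv_op2 k (riemann_in_frame (metric i) (chart i p) B).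

Definition flat (R : realType) (n : nat) (M : riemannianManifold R n) : Prop :=
  forall (p : carrier M) (i : chart_index M), dom i p ->
    forall a b c d, riemann (metric i) (chart i p) a b c d = 0.

(* Multiplication by the imaginary unit on C^m = R^m x R^m, as a matrix acting
   on row vectors from the right: (x, y) |-> (- y, x). *)
Definition stdJ (R : realType) (m : nat) : 'M[R]_(m + m) :=
  block_mx 0 1%:M (- 1%:M) 0.

(* A Kaehler manifold of complex dimension m: charts have values in C^m,
   transition maps are holomorphic (Cauchy-Riemann), the metric is Hermitian
   and the fundamental form omega(X, Y) = g(JX, Y), of coordinate matrix
   stdJ *m g, is closed. *)
Record kahlerManifold (R : realType) (m : nat) := KahlerManifold {
  kahler_riemannian :> riemannianManifold R (m + m);
  transition_holomorphic : forall (i j : chart_index kahler_riemannian)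
      (p : carrier kahler_riemannian) (v : 'rV[R]_(m + m)),
    dom i p -> dom j p ->
    'd (chart j \o param i) (chart i p) (v *m stdJ R m) =
    'd (chart j \o param i) (chart i p) v *m stdJ R m;
  metric_hermitian : forall (i : chart_index kahler_riemannian)
      (p : carrier kahler_riemannian) (v w : 'rV[R]_(m + m)), dom i p ->
    gram (metric i (chart i p)) (v *m stdJ R m) (w *m stdJ R m) =
    gram (metric i (chart i p)) v w;
  fundamental_form_closed : forall (i : chart_index kahler_riemannian)
      (p : carrier kahler_riemannian) (a b c : 'I_(m + m)), dom i p ->
    let omega a b := fun x => (stdJ R m *m metric i x) a b in
    pderiv a (omega b c) (chart i p) + pderiv b (omega c a) (chart i p)
    + pderiv c (omega a b) (chart i p) = 0
}.

(* Main.v *)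
Require Import Defs.
From HB Require Import structures.
From mathcomp Require Import all_boot all_order all_algebra.
From mathcomp Require Import all_classical all_reals all_analysis.
From mathcomp Require Import perm complex ring lra.

(** The proof is pointwise and has an algebraic and a differential part.

    Algebra.  Let T be a Kaehler curvature tensor in an orthonormal frame, J the
    orthogonal complex structure, u and v unit vectors with v orthogonal to u and
    J u.  Write H1, H2 for the holomorphic sectional curvatures of u and v, and B
    for their bisectional curvature.  By Ky Fan's inequality [ky_fan], applied to
    a basis of S^2_0 completing a given orthonormal family, the hypothesis says
    that the trace of the curvature operator over any four orthonormal traceless
    symmetric tensors is nonnegative ([sum_curv_op2_orthonormal_ge0]).  On the
    three-dimensional space of traceless Hermitian forms of the complex plane
    spanned by u and v, the trace is - (H1 + H2) / 2 - B.  On unit tensors that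
    anticommute with J the operator takes the values H1 (twice), H2 (twice) and
    2 B.  Completing the three Hermitian tensors by one of the others, and taking
    the four tensors with values H1 and H2 together, gives inequalities that force
    H1 = H2 = B = 0 ([holomorphic_sec_eq0_unit]).  So all holomorphic sectional
    curvatures vanish, and these determine a Kaehler curvature tensor by
    polarisation ([curv_eq0_of_holomorphic_sec]).

    Geometry.  It remains to see that the curvature defined by Christoffel symbols
    has the symmetries used above.  In a chart the connection in the direction i
    is a matrix G_i, and the curvature is a polynomial in the G_i and their first
    derivatives.  Skewness in the last two arguments comes from metric
    compatibility and the symmetry of second derivatives [derive_comm]; the
    Bianchi identity from the symmetry of the Christoffel symbols; the
    J-invariance from the fact that J is parallel, which for a constant J and a
    Hermitian metric is equivalent to the closedness of the fundamental form
    ([koszul_comm]).  A frame given by Gram-Schmidt then carries the curvature at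
    a point to an algebraic tensor of the first part. *)

Set Implicit Arguments.
Unset Strict Implicit.
Unset Printing Implicit Defensive.

Import Order.TTheory GRing.Theory Num.Theory.
Import numFieldNormedType.Exports.

Local Open Scope ring_scope.

(** * Orthonormal families and the sum of the smallest eigenvalues *)
Section GramSchmidt.
Variables (R : rcfType) (V : vectType R) (q : V -> V -> R).
Hypothesis qD : forall x y z, q (x + y) z = q x z + q y z.
Hypothesis qZ : forall a x z, q (a *: x) z = a * q x z.
Hypothesis q_sym : forall x y, q x y = q y x.
Hypothesis q_pos : forall x, x != 0 -> 0 < q x x.

Definition orthonormal_seq (s : seq V) :=
  forall i j, (i < size s)%N -> (j < size s)%N -> q s`_i s`_j = (i == j)%:R.

Let q0 z : q 0 z = 0.
Proof. by rewrite -(scale0r 0) qZ mul0r. Qed.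

Let q_sum n (F : 'I_n -> V) z : q (\sum_i F i) z = \sum_i q (F i) z.
Proof. by apply: (big_morph (q^~ z)) => [x y|]; rewrite ?qD ?q0. Qed.

Let q_comb n (c : 'I_n -> R) (s : seq V) (j : nat) :
  size s = n -> orthonormal_seq s ->
  q (\sum_(i < n) c i *: s`_i) s`_j = \sum_(i < n | i == j :> nat) c i.
Proof.
move=> sn os; rewrite q_sum [RHS]big_mkcond; apply: eq_bigr => i _; rewrite qZ.
have [jn|nj] := ltnP j n; first by rewrite os ?sn //; case: eqP; rewrite ?mulr1 ?mulr0.
rewrite [s`_j]nth_default ?sn // q_sym q0 mulr0; case: eqP => // E.
by move: (ltn_ord i); rewrite E ltnNge nj.
Qed.

Lemma orthonormal_free (s : seq V) : orthonormal_seq s -> free s.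
Proof.
move=> os; apply/(@freeP _ _ _ (in_tuple s)) => k k0 i.
have /= := q_comb k i erefl os; rewrite k0 q0 => /esym.
by rewrite (big_pred1 i).
Qed.

Variable P : V -> Prop.
Hypothesis P_linear : forall a x y, P x -> P y -> P (a *: x + y).

Let residue (s : seq V) x := x - \sum_(i < size s) q x s`_i *: s`_i.

Let q_residue s x (i : nat) : orthonormal_seq s -> (i < size s)%N -> q (residue s x) s`_i = 0.
Proof.
move=> os Hi; rewrite /residue qD -scaleN1r qZ q_comb // (big_pred1 (Ordinal Hi)) //=.
by rewrite mulN1r subrr.
Qed.

Let P_residue s x : (forall i, (i < size s)%N -> P s`_i) -> P x -> P (residue s x).
Proof.
move=> Ps Px; rewrite /residue -sumrN.
elim/big_rec: _ => [|i y _ Py]; first by rewrite addr0.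
by rewrite -scaleNr addrCA; apply: P_linear => //; apply: Ps.
Qed.

(** Gram-Schmidt inside the subspace of the vectors satisfying P.  As long as
    some vector of P differs from its expansion along s, the normalised
    difference extends s; the process stops because orthonormal families are
    free.  The given family stays a prefix, which lets chosen vectors be the
    first ones of a basis. *)
Lemma orthonormal_completion (s : seq V) : orthonormal_seq s ->
  (forall i, (i < size s)%N -> P s`_i) ->
  exists t, [/\ orthonormal_seq (s ++ t),
    forall i, (i < size (s ++ t))%N -> P (s ++ t)`_i &
    forall x, P x -> x = \sum_(i < size (s ++ t)) q x (s ++ t)`_i *: (s ++ t)`_i].
Proof.
have [k] := ubnP (\dim {:V} - size s); elim: k s => // k IH s ks os Ps.
have [spans|/existsNP[x /not_implyP[Px nx]]] :=
  pselect (forall x, P x -> x = \sum_(i < size s) q x s`_i *: s`_i).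
  by exists [::]; rewrite cats0.
pose r := residue s x.
have r0 : r != 0 by rewrite subr_eq0; apply/eqP.
have rr := q_pos r0.
pose e := (Num.sqrt (q r r))^-1 *: r.
have sz : size (rcons s e) = (size s).+1 by rewrite size_rcons.
have ee : q e e = 1.
  rewrite /e qZ q_sym qZ mulrA -invfM -expr2 sqr_sqrtr ?ltW // mulVf //.
  by rewrite gt_eqF.
have es i : (i < size s)%N -> q e s`_i = 0.
  by move=> Hi; rewrite /e qZ q_residue ?mulr0.
have os' : orthonormal_seq (rcons s e).
  move=> i j; rewrite sz !ltnS !nth_rcons => Hi Hj.
  case: (ltnP i (size s)) => [Hi'|Hi']; case: (ltnP j (size s)) => [Hj'|Hj'].
  - exact: os.
  - have -> : j = size s by apply/eqP; rewrite eqn_leq Hj.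
    by rewrite eqxx q_sym es // ltn_eqF.
  - have -> : i = size s by apply/eqP; rewrite eqn_leq Hi.
    by rewrite eqxx es // gtn_eqF.
  - have -> : i = size s by apply/eqP; rewrite eqn_leq Hi.
    have -> : j = size s by apply/eqP; rewrite eqn_leq Hj.
    by rewrite eqxx ee.
have Ps' i : (i < size (rcons s e))%N -> P (rcons s e)`_i.
  rewrite sz ltnS nth_rcons => Hi; case: ltnP => Hi'; first exact: Ps.
  have -> : i = size s by apply/eqP; rewrite eqn_leq Hi.
  have P0 : P 0 by rewrite -(subrr x) -scaleN1r addrC; apply: P_linear.
  by rewrite eqxx /e -[_ *: r]addr0; apply: P_linear => //; apply: P_residue.
have dims : (size (rcons s e) <= \dim {:V})%N.
  by have /eqP <- := orthonormal_free os'; apply/dimvS/subvf.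
have [|t [ot Pt tspan]] := IH (rcons s e) _ os' Ps'.
  rewrite size_rcons in dims *; rewrite subnS; move: ks.
  by case: (_ - _)%N (subn_gt0 (size s) (\dim {: V})) => //; rewrite dims.
by exists (e :: t); rewrite -cat_rcons.
Qed.

Lemma orthonormal_basis_size (s : seq V) : orthonormal_seq s ->
  (forall x, x = \sum_(i < size s) q x s`_i *: s`_i) -> size s = dim V.
Proof.
move=> os spans; have /eqP <- := orthonormal_free os; rewrite -dimvf.
congr (\dim _); apply/eqP; rewrite eqEsubv subvf; apply/subvP => x _.
by rewrite (spans x) memv_suml // => i _; rewrite memvZ // memv_span // mem_nth.
Qed.

End GramSchmidt.

Section KyFan.
Local Open Scope sesquilinear_scope.
Variable R : rcfType.

(** The bathtub principle behind Ky Fan's inequality: moving weight towards the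
    first entries of a sorted list decreases the weighted sum, and the bound 1 on
    the weights stops this at the k first entries. *)
Lemma sum_take_le_weighted N (s : seq R) (w : 'I_N -> R) (k : nat) :
  size s = N -> sorted <=%R s -> (k <= N)%N ->
  (forall i, 0 <= w i <= 1) -> \sum_i w i = k%:R ->
  \sum_(l <- take k s) l <= \sum_i w i * s`_i.
Proof.
move=> sN s_sorted kN w01 wk.
have s_mono i j : (i <= j)%N -> (j < N)%N -> s`_i <= s`_j.
  move=> ij jN; apply: sorted_leq_nth => //; rewrite ?inE ?sN //; [exact: le_trans|].
  exact: leq_ltn_trans jN.
(* Shifting all entries by the k-th one, mu, changes both sides by k * mu, and
   turns their difference into a sum of nonnegative terms.  For k = 0, mu is
   the least entry, which has the same effect. *)
pose mu := s`_k.-1.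
have -> : \sum_(l <- take k s) l = \sum_(i < N) (i < k)%N%:R * s`_i.
  rewrite (big_nth 0) size_takel ?sN // big_mkord.
  rewrite (big_ord_widen _ (fun i => (take k s)`_i) kN) big_mkcond.
  by apply: eq_bigr => i _; case: ltnP => [?|_]; rewrite ?mul0r // nth_take ?mul1r.
have ck : \sum_(i < N) (i < k)%N%:R = k%:R :> R.
  rewrite -natr_sum -[k in RHS]card_ord -sum1_card (big_ord_widen _ (fun=> 1%N) kN).
  by rewrite [in RHS]big_mkcond; congr _%:R; apply: eq_bigr => i _; case: ltnP.
have zero : \sum_(i < N) (w i - (i < k)%N%:R) * mu = 0.
  by rewrite -mulr_suml sumrB wk ck subrr mul0r.
have : 0 <= \sum_(i < N) (w i - (i < k)%N%:R) * (s`_i - mu).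
  apply: sumr_ge0 => i _; have /andP[w0 w1] := w01 i.
  case: ltnP => ik.
    apply: mulr_le0; rewrite subr_le0 //; apply: s_mono.
      by rewrite -ltnS (ltn_predK ik).
    by apply: leq_trans kN; rewrite (ltn_predK ik).
  apply: mulr_ge0; rewrite subr_ge0 //; apply: s_mono => //.
  exact: leq_trans (leq_pred k) ik.
under eq_bigr do rewrite mulrBr; rewrite sumrB zero subr0.
by under eq_bigr do rewrite mulrBl; rewrite sumrB subr_ge0.
Qed.

Lemma char_poly_similar (F : fieldType) n (P A B : 'M[F]_n) :
  P \in unitmx -> A = invmx P *m B *m P -> char_poly A = char_poly B.
Proof.
move=> Pu ->; rewrite /char_poly.
have -> : char_poly_mx (invmx P *m B *m P) =
    map_mx polyC (invmx P) *m char_poly_mx B *m map_mx polyC P.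
  rewrite /char_poly_mx mulmxBr mulmxBl -!map_mxM mul_mx_scalar -scalemxAl.
  by rewrite -map_mxM mulVmx // map_mx1 scalemx1.
rewrite !det_mulmx mulrAC -det_mulmx -map_mxM mulVmx // map_mx1 det1 mul1r //.
Qed.

Local Notation toC := (real_complex R).

(** Ky Fan's inequality.  The spectral theorem over R[i] writes the diagonal
    entry a of A as the sum over j of `|P j a| ^+ 2 times the eigenvalue j, with
    P unitary; summing over a < k gives each eigenvalue a weight in [0, 1], and
    these weights have total k. *)
Lemma ky_fan N (A : 'M[R]_N) (s : seq R) (k : nat) :
  A^T = A -> sorted <=%R s -> char_poly A = \prod_(l <- s) ('X - l%:P) ->
  (k <= N)%N -> \sum_(l <- take k s) l <= \sum_(a < N | (a < k)%N) A a a.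
Proof.
move=> As s_sorted charA kN.
pose AC := map_mx toC A.
have ACn : AC \is normalmx.
  apply/hermitian_normalmx/realsym_hermsym.
    by apply/is_hermitianmxP/matrixP => i j; rewrite !mxE mul1r -[in LHS]As mxE.
  by apply/mxOverP => i j; rewrite mxE; apply/complex_realP; exists (A i j).
pose P := spectralmx AC; pose d := spectral_diag AC.
have Pu : P \is unitarymx := spectral_unitarymx AC.
have /orthomx_spectralP ACE : AC \is normalmx by [].
have charAC : char_poly AC = \prod_(l <- [tuple d 0 i | i < N]) ('X - l%:P).
  rewrite (char_poly_similar (unitarymx_unit Pu) ACE) char_poly_trig ?diag_mx_is_trig //.
  by rewrite big_tuple; apply: eq_bigr => i _; rewrite tnth_mktuple mxE eqxx.
have : perm_eq (map toC s) [tuple d 0 i | i < N].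
  apply: prod_XsubC_eq; rewrite -charAC -map_char_poly charA rmorph_prod /= big_map.
  by apply: eq_bigr => l _; rewrite rmorphB /= map_polyX map_polyC.
case/tuple_permP => p sp.
have sN : size s = N by have := congr1 size sp; rewrite size_map size_tuple.
have sE (i : 'I_N) : toC s`_i = d 0 (p i).
  by rewrite -(nth_map 0 0) ?sN // sp -tnth_nth !tnth_mktuple.
have normE (z : complex R) : toC (ComplexField.Normc.normc z ^+ 2) = z * z^*.
  by rewrite rmorphXn /= -normCK.
pose n2 j a := ComplexField.Normc.normc (P j a) ^+ 2.
have n2_ge0 j a : 0 <= n2 j a by rewrite sqr_ge0.
have n2_row j : \sum_a n2 j a = 1.
  apply: (@complexI R); rewrite rmorph_sum /= rmorph1.
  have /unitarymxP/matrixP/(_ j j) := Pu; rewrite !mxE eqxx mulr1n => <-.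
  by apply: eq_bigr => a _; rewrite normE !mxE.
have PP : P^t* *m P = 1%:M by rewrite -invmx_unitary // mulVmx ?unitarymx_unit.
have n2_col a : \sum_j n2 j a = 1.
  apply: (@complexI R); rewrite rmorph_sum /= rmorph1.
  have /matrixP/(_ a a) := PP; rewrite !mxE eqxx mulr1n => <-.
  by apply: eq_bigr => j _; rewrite normE !mxE mulrC.
have diagE a : A a a = \sum_i n2 (p i) a * s`_i.
  apply: (@complexI R); have /matrixP/(_ a a) := ACE; rewrite [LHS]mxE => ->.
  rewrite -/P -/d invmx_unitary // mul_mx_diag mxE (reindex_inj (@perm_inj _ p)).
  rewrite rmorph_sum; apply: eq_bigr => i _.
  by rewrite rmorphM /= sE normE !mxE mulrAC [_ * P _ _]mulrC.
under [leRHS]eq_bigr do rewrite diagE.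
rewrite exchange_big /=; under [leRHS]eq_bigr do rewrite -mulr_suml.
apply: sum_take_le_weighted => // [i|].
  rewrite sumr_ge0 //= -(n2_row (p i)) [leRHS](bigID (fun a : 'I_N => (a < k)%N)) /=.
  by rewrite lerDl sumr_ge0.
rewrite exchange_big /=.
under eq_bigr => a _.
  have -> : \sum_i n2 (p i) a = 1 by rewrite -(n2_col a) [RHS](reindex_inj (@perm_inj _ p)).
  over.
by rewrite -(big_ord_widen _ (fun=> 1) kN) sumr_const card_ord.
Qed.
End KyFan.

(** * The curvature operator of the second kind on chosen tensors *)

Section Frobenius.
Variables (R : realType) (m n : nat).
Implicit Types A B C : 'M[R]_(m, n).

Definition frob A B := \tr (A^T *m B).

Lemma frobE A B : frob A B = \sum_i \sum_j A i j * B i j.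
Proof.
rewrite /frob /mxtrace exchange_big; apply: eq_bigr => j _; rewrite mxE.
by apply: eq_bigr => i _; rewrite mxE.
Qed.

Lemma frobD A B C : frob (A + B) C = frob A C + frob B C.
Proof. by rewrite /frob linearD mulmxDl mxtraceD. Qed.

Lemma frobZ a A B : frob (a *: A) B = a * frob A B.
Proof. by rewrite /frob linearZ /= -scalemxAl mxtraceZ. Qed.

Lemma frobC A B : frob A B = frob B A.
Proof. by rewrite /frob -mxtrace_tr trmx_mul trmxK. Qed.

Lemma frobDr A B C : frob A (B + C) = frob A B + frob A C.
Proof. by rewrite frobC frobD !(frobC _ A). Qed.

Lemma frobZr a A B : frob A (a *: B) = a * frob A B.
Proof. by rewrite frobC frobZ frobC. Qed.

Lemma frob_pos A : A != 0 -> 0 < frob A A.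
Proof.
move=> A0; rewrite lt_def frobE; apply/andP; split; last first.
  by apply: sumr_ge0 => i _; apply: sumr_ge0 => j _; rewrite -expr2 sqr_ge0.
apply: contra A0 => /eqP s0; apply/eqP/matrixP => i j; rewrite mxE; apply/eqP.
have sq i' j' : 0 <= A i' j' * A i' j' by rewrite -expr2 sqr_ge0.
have row_ge0 i' : true -> 0 <= \sum_j A i' j * A i' j by move=> _; apply: sumr_ge0.
have /(_ i isT) := psumr_eq0P row_ge0 s0.
move=> /psumr_eq0P -/(_ (fun j _ => sq i j) j isT)/eqP.
by rewrite mulf_eq0 orbb.
Qed.

End Frobenius.

Section CurvatureForm.
Variables (R : realType) (n : nat).
Local Notation E := 'rV[R]_n.
Implicit Types (T : tensor4 R n) (A B : 'M[R]_n) (x y z w : E).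

Lemma curv_op2D T A A' B : curv_op2 T (A + A') B = curv_op2 T A B + curv_op2 T A' B.
Proof.
rewrite /curv_op2 -big_split; apply: eq_bigr => i _ /=.
rewrite -big_split; apply: eq_bigr => j _ /=.
rewrite -big_split; apply: eq_bigr => k _ /=.
by rewrite -big_split; apply: eq_bigr => l _ /=; rewrite mxE mulrDr mulrDl.
Qed.

Lemma curv_op2Z T a A B : curv_op2 T (a *: A) B = a * curv_op2 T A B.
Proof.
rewrite /curv_op2 mulr_sumr; apply: eq_bigr => i _ /=.
rewrite mulr_sumr; apply: eq_bigr => j _ /=.
rewrite mulr_sumr; apply: eq_bigr => k _ /=.
by rewrite mulr_sumr; apply: eq_bigr => l _ /=; rewrite mxE; ring.
Qed.

Lemma curv_op2C T A B : (forall i j k l, T i j k l = T j i l k) ->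
  curv_op2 T A B = curv_op2 T B A.
Proof.
move=> Tsym; rewrite /curv_op2 exchange_big; apply: eq_bigr => i _ /=.
apply: eq_bigr => j _; rewrite exchange_big; apply: eq_bigr => k _ /=.
by apply: eq_bigr => l _; rewrite Tsym mulrAC.
Qed.

(** The hypothesis on eigenvalues becomes usable on chosen tensors: an
    orthonormal family of k elements of S^2_0 extends to a basis, and by Ky Fan
    the trace over the family bounds the k smallest eigenvalues from above. *)
Lemma sum_curv_op2_orthonormal_ge0 T (s : seq 'M[R]_n) :
  (forall i j k l, T i j k l = T j i l k) ->
  k_nonneg_curv_op2 (size s) T -> orthonormal_seq (@frob R n n) s ->
  (forall i, (i < size s)%N -> traceless_sym s`_i) ->
  0 <= \sum_(i < size s) curv_op2 T s`_i s`_i.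
Proof.
move=> Tsym Tk os s20.
have tsL a A B : traceless_sym A -> traceless_sym B -> traceless_sym (a *: A + B).
  move=> [A1 A2] [B1 B2]; split; first by rewrite linearD linearZ /= A1 B1.
  by rewrite mxtraceD mxtraceZ A2 B2 mulr0 addr0.
have [t [ot t20 tspan]] := orthonormal_completion (@frobD _ _ _) (@frobZ _ _ _) (@frobC _ _ _)
  (@frob_pos _ _ _) tsL os s20.
pose N := size (s ++ t); pose phi (a : 'I_N) := (s ++ t)`_a.
have [|e [e_sorted e_char] e_ge0] := Tk N phi.
  split=> [a|a b|A /tspan AE]; first exact: t20.
    exact: ot.
  by exists (fun a => frob A (s ++ t)`_a).
apply: le_trans e_ge0 _.
have sN : (size s <= N)%N by rewrite /N size_cat leq_addr.
have curv_mx_sym : (curv_op2_mx T phi)^T = curv_op2_mx T phi.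
  by apply/matrixP => a b; rewrite !mxE curv_op2C.
apply: le_trans (ky_fan curv_mx_sym e_sorted e_char sN) _.
rewrite (big_ord_widen _ (fun i => curv_op2 T s`_i s`_i) sN) le_eqVlt; apply/orP; left.
by apply/eqP/eq_bigr => a ha; rewrite mxE /phi nth_cat ha.
Qed.

(** The 4-linear form with components T.  Expressing it through curv_op2 makes
    it multilinear at once, and makes curv_op2 on rank-one tensors one of its
    values by definition. *)
Definition curv_form T x y z w := curv_op2 T (x^T *m w) (y^T *m z).

Lemma curv_formE T x y z w : curv_form T x y z w =
  \sum_i \sum_j \sum_k \sum_l T i j k l * x 0 i * y 0 j * z 0 k * w 0 l.
Proof.
do 4 (apply: eq_bigr => ? _); rewrite !mxE !big_ord1 !mxE; ring.
Qed.

Lemma curv_form_delta T i j k l :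
  curv_form T (delta_mx 0 i) (delta_mx 0 j) (delta_mx 0 k) (delta_mx 0 l) = T i j k l.
Proof.
rewrite curv_formE (bigD1 i) //= [X in _ + X]big1 ?addr0; last first.
  move=> i' /negPf ni; apply: big1 => j' _; apply: big1 => k' _; apply: big1 => l' _.
  by rewrite mxE ni andbF mulr0 !mul0r.
rewrite (bigD1 j) //= [X in _ + X]big1 ?addr0; last first.
  move=> j' /negPf ni; apply: big1 => k' _; apply: big1 => l' _.
  by rewrite [delta_mx 0 j 0 j']mxE ni andbF mulr0 !mul0r.
rewrite (bigD1 k) //= [X in _ + X]big1 ?addr0; last first.
  move=> k' /negPf ni; apply: big1 => l' _.
  by rewrite [delta_mx 0 k 0 k']mxE ni andbF mulr0 !mul0r.
rewrite (bigD1 l) //= [X in _ + X]big1 ?addr0; last first.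
  by move=> l' /negPf ni; rewrite [delta_mx 0 l 0 l']mxE ni andbF mulr0.
by rewrite !mxE !eqxx /= !mulr1.
Qed.

End CurvatureForm.

(** * Algebraic Kaehler curvature forms *)
Section KahlerForm.
Variables (R : realFieldType) (E : lmodType R) (Q : E -> E -> E -> E -> R).

Record curvature_like : Prop := CurvatureLike {
  curv_lin : forall a x x' y z w, Q (a *: x + x') y z w = a * Q x y z w + Q x' y z w;
  curv_skew12 : forall x y z w, Q x y z w = - Q y x z w;
  curv_skew34 : forall x y z w, Q x y z w = - Q x y w z;
  curv_bianchi : forall x y z w, Q x y z w + Q y z x w + Q z x y w = 0 }.

Hypothesis QC : curvature_like.
Let Q12 := curv_skew12 QC.
Let Q34 := curv_skew34 QC.

(** The alternating sum of the four Bianchi identities obtained by rotating the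
    arguments. *)
Lemma curv_pair x y z w : Q x y z w = Q z w x y.
Proof.
have := curv_bianchi QC x y z w; have := curv_bianchi QC y z w x.
have := curv_bianchi QC z w x y; have := curv_bianchi QC w x y z.
rewrite (Q34 y z w) (Q34 z w y) (Q34 x y w) (Q34 w x z) (Q12 x z) (Q34 z x w).
rewrite (Q12 y w) (Q34 w y x); lra.
Qed.

Let QD1 x x' y z w : Q (x + x') y z w = Q x y z w + Q x' y z w.
Proof. by rewrite -{1}(scale1r x) (curv_lin QC) mul1r. Qed.

Let QZ1 a x y z w : Q (a *: x) y z w = a * Q x y z w.
Proof.
have Q0 : Q 0 y z w = 0 by have := QD1 0 0 y z w; rewrite addr0; lra.
by rewrite -[a *: x]addr0 (curv_lin QC) Q0 addr0.
Qed.

Let QD2 x y y' z w : Q x (y + y') z w = Q x y z w + Q x y' z w.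
Proof. by rewrite Q12 QD1 opprD -!(Q12 x). Qed.

Let QD3 x y z z' w : Q x y (z + z') w = Q x y z w + Q x y z' w.
Proof. by rewrite curv_pair QD1 ![Q _ w x y]curv_pair. Qed.

Let QD4 x y z w w' : Q x y z (w + w') = Q x y z w + Q x y z w'.
Proof. by rewrite Q34 QD3 opprD -!(Q34 x y z). Qed.

Lemma curvN1 x y z w : Q (- x) y z w = - Q x y z w.
Proof. by rewrite -scaleN1r QZ1 mulN1r. Qed.

Lemma curvN2 x y z w : Q x (- y) z w = - Q x y z w.
Proof. by rewrite Q12 curvN1 -Q12. Qed.

Lemma curvN3 x y z w : Q x y (- z) w = - Q x y z w.
Proof. by rewrite curv_pair curvN1 -curv_pair. Qed.

Lemma curvN4 x y z w : Q x y z (- w) = - Q x y z w.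
Proof. by rewrite Q34 curvN3 -Q34. Qed.

Lemma curvZ2 a x y z w : Q x (a *: y) z w = a * Q x y z w.
Proof. by rewrite Q12 QZ1 -mulrN -Q12. Qed.

Lemma curv_sec_scale a x y : Q (a *: x) (a *: y) (a *: x) (a *: y) = a ^+ 4 * Q x y x y.
Proof. by rewrite QZ1 curvZ2 curv_pair QZ1 curvZ2; ring. Qed.

(** Polarising in the second and fourth arguments gives Q x y x w = 0, hence Q
    is also skew in its first and third arguments; the three terms of the
    Bianchi identity are then equal. *)
Lemma curv_eq0_of_sec : (forall x y, Q x y x y = 0) -> forall x y z w, Q x y z w = 0.
Proof.
move=> sec0.
have Qxyxw x y w : Q x y x w = 0.
  have := sec0 x (y + w); rewrite QD2 !QD4 !sec0 (curv_pair x w x y); lra.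
move=> x y z w.
have swap13 a b c d : Q a b c d = - Q c b a d.
  have := Qxyxw (a + c) b d; rewrite QD1 !QD3 !Qxyxw; lra.
have := curv_bianchi QC x y z w.
by rewrite (swap13 y z x) (Q12 x z y) (Q12 z x y) (swap13 x z y) (Q12 y z x) (swap13 z y x); lra.
Qed.

Variable J : E -> E.
Hypothesis JD : forall x y, J (x + y) = J x + J y.
Hypothesis JN : forall x, J (- x) = - J x.
Hypothesis JJ : forall x, J (J x) = - x.
Hypothesis QJ : forall x y z w, Q x y (J z) (J w) = Q x y z w.

Lemma curvJ12 x y z w : Q (J x) (J y) z w = Q x y z w.
Proof. by rewrite curv_pair QJ curv_pair. Qed.

Lemma curvJ1 x y z w : Q (J x) y z w = - Q x (J y) z w.
Proof. by rewrite -(curvJ12 x (J y)) JJ curvN2 opprK. Qed.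

(** Bianchi identity on x, J x, y, where the J-invariance turns the last two
    terms into sectional curvatures. *)
Lemma curv_bisectional x y :
  Q x (J x) y (J y) = Q x y x y + Q x (J y) x (J y).
Proof.
have := curv_bianchi QC x (J x) y (J y).
by rewrite curvJ1 (Q12 y x) QJ; lra.
Qed.

(** The holomorphic sectional curvature determines the curvature of a Kaehler
    form.  Let K be the sectional curvature and H(x) = Q x (J x) x (J x).  The
    part of H(x + y) + H(x - y) of degree two in x, together with the bisectional
    identity, gives K(x, y) + 3 K(x, J y) = 0; replacing y by J y gives
    K(x, J y) + 3 K(x, y) = 0, so that K vanishes. *)
Lemma curv_eq0_of_holomorphic_sec :
  (forall x, Q x (J x) x (J x) = 0) -> forall x y z w, Q x y z w = 0.
Proof.
move=> H0; apply: curv_eq0_of_sec.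
have K13 x y : Q x y x y + 3 * Q x (J y) x (J y) = 0.
  have := H0 (x + y); have := H0 (x - y).
  rewrite !JD !JN !(QD1, QD2, QD3, QD4, curvN1, curvN2, curvN3, curvN4) !H0.
  have := curv_bisectional x y.
  rewrite (curv_pair y (J y) x (J x)).
  have sw a b c d : Q a (J b) c (J d) = Q b (J a) c (J d).
    by rewrite Q12 curvJ1 opprK.
  have sw' a b c d : Q a (J b) c (J d) = Q a (J b) d (J c).
    by rewrite curv_pair sw curv_pair.
  rewrite !(sw y x) !(sw' _ _ y x); lra.
move=> x y; have := K13 x y; have := K13 x (J y).
rewrite JJ curvN2 curvN4; lra.
Qed.
End KahlerForm.

(** * Four test families *)
Section FourNonneg.
Variables (R : realType) (n : nat).
Local Notation E := 'rV[R]_n.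
Implicit Types (A B C : 'M[R]_n) (x y z w : E).

Definition symprod x y : 'M[R]_n := x^T *m y + y^T *m x.

Lemma frob_rank1 x y z w : frob (x^T *m y) (z^T *m w) = frob x z * frob y w.
Proof.
rewrite /frob trmx_mul trmxK -!mulmxA (mulmxA x) [x *m z^T]mx11_scalar mul_scalar_mx.
rewrite -scalemxAr mxtraceZ; congr (_ * _).
by rewrite -mxtrace_tr trmx_mul trmxK mxtrace_mulC /mxtrace big_ord1.
Qed.

Lemma frob_symprod x y z w :
  frob (symprod x y) (symprod z w) = 2 * (frob x z * frob y w + frob x w * frob y z).
Proof. rewrite /symprod !(frobD, frobDr) !frob_rank1; ring. Qed.

Lemma tr_symprod x y : \tr (symprod x y) = 2 * frob x y.
Proof. by rewrite mxtraceD -/(frob x y) -/(frob y x) (frobC y); ring. Qed.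

Lemma traceless_symprod a b x y z w : a * frob x y + b * frob z w = 0 ->
  traceless_sym (a *: symprod x y + b *: symprod z w).
Proof.
move=> tr0; split; last by rewrite mxtraceD !mxtraceZ !tr_symprod; lra.
by rewrite linearD !linearZ /= ![(symprod _ _)^T]linearD /= !trmx_mul !trmxK ![symprod _ _]addrC.
Qed.

Variable T : tensor4 R n.
Hypothesis TC : curvature_like (curv_form T).

Lemma curv_op2_sym A B : curv_op2 T A B = curv_op2 T B A.
Proof.
apply: curv_op2C => i j k l.
by rewrite -!curv_form_delta (curv_skew12 TC) (curv_skew34 TC) opprK.
Qed.

(** Four values of the form appear by bilinearity; the pair symmetry makes them
    equal two by two. *)
Lemma curv_op2_symprod x y z w : curv_op2 T (symprod x y) (symprod z w) =
  2 * (curv_form T x z w y + curv_form T x w z y).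
Proof.
rewrite /symprod curv_op2D !(curv_op2_sym _ (_ + _)) !curv_op2D.
rewrite -!/(curv_form T _ _ _ _).
rewrite (curv_pair TC z y) (curv_pair TC w y).
rewrite (curv_skew12 TC z x) (curv_skew34 TC x z) (curv_skew12 TC w x) (curv_skew34 TC x w).
ring.
Qed.

Lemma curv_form_diag x z w : curv_form T x x z w = 0.
Proof. have := curv_skew12 TC x x z w; lra. Qed.

Lemma quadruple_nonneg A B C D : k_nonneg_curv_op2 4 T ->
  [/\ traceless_sym A, traceless_sym B, traceless_sym C & traceless_sym D] ->
  [/\ frob A A = 1, frob B B = 1, frob C C = 1 & frob D D = 1] ->
  [/\ frob A B = 0, frob A C = 0 & frob A D = 0] ->
  [/\ frob B C = 0, frob B D = 0 & frob C D = 0] ->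
  0 <= curv_op2 T A A + curv_op2 T B B + curv_op2 T C C + curv_op2 T D D.
Proof.
move=> T4 [A0 B0 C0 D0] [AA BB CC DD] [AB AC AD] [BC BD CD].
have := @sum_curv_op2_orthonormal_ge0 _ _ T [:: A; B; C; D].
rewrite !big_ord_recr big_ord0 /= add0r; apply => //.
- by move=> i j k l; rewrite -!curv_form_delta (curv_skew12 TC) (curv_skew34 TC) opprK.
- move=> [|[|[|[|i]]]] [|[|[|[|j]]]] //= _ _;
  by rewrite ?AA ?BB ?CC ?DD ?AB ?AC ?AD ?BC ?BD ?CD // frobC ?AB ?AC ?AD ?BC ?BD ?CD.
- by move=> [|[|[|[|i]]]].
Qed.

Definition symprod2 (a : R) x y (b : R) z w : 'M[R]_n := a *: symprod x y + b *: symprod z w.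

Lemma frob_symprod2 a x y b z w a' x' y' b' z' w' :
  frob (symprod2 a x y b z w) (symprod2 a' x' y' b' z' w') =
  2 * (a * a' * (frob x x' * frob y y' + frob x y' * frob y x')
     + a * b' * (frob x z' * frob y w' + frob x w' * frob y z')
     + b * a' * (frob z x' * frob w y' + frob z y' * frob w x')
     + b * b' * (frob z z' * frob w w' + frob z w' * frob w z')).
Proof. rewrite /symprod2 frobD !frobZ 2!frobDr !frobZr !frob_symprod; ring. Qed.

Lemma curv_op2_symprod2 a x y b z w a' x' y' b' z' w' :
  curv_op2 T (symprod2 a x y b z w) (symprod2 a' x' y' b' z' w') =
  2 * (a * a' * (curv_form T x x' y' y + curv_form T x y' x' y)
     + a * b' * (curv_form T x z' w' y + curv_form T x w' z' y)
     + b * a' * (curv_form T z x' y' w + curv_form T z y' x' w)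
     + b * b' * (curv_form T z z' w' w + curv_form T z w' z' w)).
Proof.
rewrite /symprod2 curv_op2D !curv_op2Z.
rewrite ![curv_op2 T (symprod _ _) (_ *: _ + _)]curv_op2_sym.
rewrite 2!curv_op2D !curv_op2Z ![curv_op2 T (symprod x' y') _]curv_op2_sym.
rewrite ![curv_op2 T (symprod z' w') _]curv_op2_sym.
rewrite !curv_op2_symprod; ring.
Qed.


(** Think of e1, e2, e3, e4 as u, J u, v, J v.  The tensors h1, h2, h3 below are
    an orthonormal basis of the traceless Hermitian forms on the complex span of
    u and v, and trh is the trace of the curvature operator over them; b and the
    a_i anticommute with J.  On the complex projective plane the h_i span the negative
    eigenspace, which suggests the families made of h1, h2, h3 and one of
    a1, a3, b; the last family is a1, a2, a3, a4. *)
Lemma four_nonneg_orthonormal e1 e2 e3 e4 : k_nonneg_curv_op2 4 T ->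
  orthonormal_seq (@frob R 1 n) [:: e1; e2; e3; e4] ->
  let q := curv_form T in
  let K x y := q x y x y in
  let trh := K e1 e3 + K e1 e4 + K e2 e3 + K e2 e4 - (K e1 e2 + K e3 e4) / 2
             - 3 * q e1 e2 e3 e4 in
  [/\ 0 <= trh + K e1 e2, 0 <= trh + K e3 e4,
      0 <= trh + (K e1 e3 + K e2 e4) / 2 + q e1 e2 e3 e4 - q e1 e4 e2 e3 &
      0 <= K e1 e2 + K e3 e4].
Proof.
move=> T4 oe q K trh.
have f11 : frob e1 e1 = 1 := oe 0%N 0%N isT isT.
have f12 : frob e1 e2 = 0 := oe 0%N 1%N isT isT.
have f13 : frob e1 e3 = 0 := oe 0%N 2%N isT isT.
have f14 : frob e1 e4 = 0 := oe 0%N 3%N isT isT.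
have f21 : frob e2 e1 = 0 := oe 1%N 0%N isT isT.
have f22 : frob e2 e2 = 1 := oe 1%N 1%N isT isT.
have f23 : frob e2 e3 = 0 := oe 1%N 2%N isT isT.
have f24 : frob e2 e4 = 0 := oe 1%N 3%N isT isT.
have f31 : frob e3 e1 = 0 := oe 2%N 0%N isT isT.
have f32 : frob e3 e2 = 0 := oe 2%N 1%N isT isT.
have f33 : frob e3 e3 = 1 := oe 2%N 2%N isT isT.
have f34 : frob e3 e4 = 0 := oe 2%N 3%N isT isT.
have f41 : frob e4 e1 = 0 := oe 3%N 0%N isT isT.
have f42 : frob e4 e2 = 0 := oe 3%N 1%N isT isT.
have f43 : frob e4 e3 = 0 := oe 3%N 2%N isT isT.
have f44 : frob e4 e4 = 1 := oe 3%N 3%N isT isT.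
pose dots := (f11, f12, f13, f14, (f21, f22, f23, f24), (f31, f32, f33, f34), (f41, f42, f43, f44)).
(* normalises the a_i *)
have [r rr] : exists r : R, r * r = 2^-1.
  by exists (Num.sqrt 2^-1); rewrite -expr2 sqr_sqrtr // invr_ge0.
(* h1 is half of e1^2 + e2^2 - e3^2 - e4^2, and symprod e e is twice the square of e *)
pose s := symprod2 4^-1 e1 e1 4^-1 e2 e2; pose t := symprod2 (- 4^-1) e3 e3 (- 4^-1) e4 e4.
pose h1 := s + t.
pose h2 := symprod2 2^-1 e1 e3 2^-1 e2 e4.
pose h3 := symprod2 2^-1 e1 e4 (- 2^-1) e2 e3.
pose a1 := symprod2 (r / 2) e1 e1 (- (r / 2)) e2 e2.
pose a2 := symprod2 r e1 e2 0 e1 e2.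
pose a3 := symprod2 (r / 2) e3 e3 (- (r / 2)) e4 e4.
pose a4 := symprod2 r e3 e4 0 e3 e4.
pose b := symprod2 2^-1 e1 e3 (- 2^-1) e2 e4.
have ts1 : traceless_sym h1.
  rewrite /h1; have -> : s + t =
      symprod2 4^-1 e1 e1 (- 4^-1) e3 e3 + symprod2 4^-1 e2 e2 (- 4^-1) e4 e4.
    by rewrite /s /t /symprod2 addrACA.
  have [A1 A2] : traceless_sym (symprod2 4^-1 e1 e1 (- 4^-1) e3 e3).
    by apply: traceless_symprod; rewrite f11 f33; ring.
  have [B1 B2] : traceless_sym (symprod2 4^-1 e2 e2 (- 4^-1) e4 e4).
    by apply: traceless_symprod; rewrite f22 f44; ring.
  by split; rewrite linearD /= ?A1 ?B1 ?A2 ?B2 ?addr0.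
have ts2 : traceless_sym h2 by apply: traceless_symprod; rewrite !dots; ring.
have ts3 : traceless_sym h3 by apply: traceless_symprod; rewrite !dots; ring.
have tsa1 : traceless_sym a1 by apply: traceless_symprod; rewrite !dots; ring.
have tsa2 : traceless_sym a2 by apply: traceless_symprod; rewrite !dots; ring.
have tsa3 : traceless_sym a3 by apply: traceless_symprod; rewrite !dots; ring.
have tsa4 : traceless_sym a4 by apply: traceless_symprod; rewrite !dots; ring.
have tsb : traceless_sym b by apply: traceless_symprod; rewrite !dots; ring.
have g11 : frob h1 h1 = 1.
  by rewrite frobD [frob s h1]frobDr [frob t h1]frobDr !frob_symprod2 !dots; field.
have g12 : frob h1 h2 = 0 by rewrite frobD !frob_symprod2 !dots; ring.
have g13 : frob h1 h3 = 0 by rewrite frobD !frob_symprod2 !dots; ring.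
have g1a1 : frob h1 a1 = 0 by rewrite frobD !frob_symprod2 !dots; ring.
have g1a3 : frob h1 a3 = 0 by rewrite frobD !frob_symprod2 !dots; ring.
have g1b : frob h1 b = 0 by rewrite frobD !frob_symprod2 !dots; ring.
have g22 : frob h2 h2 = 1 by rewrite !frob_symprod2 !dots; field.
have g23 : frob h2 h3 = 0 by rewrite !frob_symprod2 !dots; ring.
have g2a1 : frob h2 a1 = 0 by rewrite !frob_symprod2 !dots; ring.
have g2a3 : frob h2 a3 = 0 by rewrite !frob_symprod2 !dots; ring.
have g2b : frob h2 b = 0 by rewrite !frob_symprod2 !dots; ring.
have g33 : frob h3 h3 = 1 by rewrite !frob_symprod2 !dots; field.
have g3a1 : frob h3 a1 = 0 by rewrite !frob_symprod2 !dots; ring.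
have g3a3 : frob h3 a3 = 0 by rewrite !frob_symprod2 !dots; ring.
have g3b : frob h3 b = 0 by rewrite !frob_symprod2 !dots; ring.
have ga11 : frob a1 a1 = 1.
  by rewrite !frob_symprod2 !dots; transitivity (2 * (r * r)); [field|rewrite rr; field].
have ga12 : frob a1 a2 = 0 by rewrite !frob_symprod2 !dots; ring.
have ga13 : frob a1 a3 = 0 by rewrite !frob_symprod2 !dots; ring.
have ga14 : frob a1 a4 = 0 by rewrite !frob_symprod2 !dots; ring.
have ga22 : frob a2 a2 = 1.
  by rewrite !frob_symprod2 !dots; transitivity (2 * (r * r)); [field|rewrite rr; field].
have ga23 : frob a2 a3 = 0 by rewrite !frob_symprod2 !dots; ring.
have ga24 : frob a2 a4 = 0 by rewrite !frob_symprod2 !dots; ring.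
have ga33 : frob a3 a3 = 1.
  by rewrite !frob_symprod2 !dots; transitivity (2 * (r * r)); [field|rewrite rr; field].
have ga34 : frob a3 a4 = 0 by rewrite !frob_symprod2 !dots; ring.
have ga44 : frob a4 a4 = 1.
  by rewrite !frob_symprod2 !dots; transitivity (2 * (r * r)); [field|rewrite rr; field].
have gbb : frob b b = 1 by rewrite !frob_symprod2 !dots; field.
have I1 := quadruple_nonneg T4 (And4 ts1 ts2 ts3 tsa1) (And4 g11 g22 g33 ga11)
  (And3 g12 g13 g1a1) (And3 g23 g2a1 g3a1).
have I2 := quadruple_nonneg T4 (And4 ts1 ts2 ts3 tsa3) (And4 g11 g22 g33 ga33)
  (And3 g12 g13 g1a3) (And3 g23 g2a3 g3a3).
have I3 := quadruple_nonneg T4 (And4 ts1 ts2 ts3 tsb) (And4 g11 g22 g33 gbb)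
  (And3 g12 g13 g1b) (And3 g23 g2b g3b).
have I4 := quadruple_nonneg T4 (And4 tsa1 tsa2 tsa3 tsa4) (And4 ga11 ga22 ga33 ga44)
  (And3 ga12 ga13 ga14) (And3 ga23 ga24 ga34).
have q11 := curv_form_diag.
have q1212 x y : curv_form T x y y x = - K x y by rewrite (curv_skew34 TC).
have qh1 : curv_op2 T h1 h1 = (K e1 e3 + K e1 e4 + K e2 e3 + K e2 e4 - K e1 e2 - K e3 e4) / 2.
  rewrite curv_op2D [curv_op2 T s h1]curv_op2_sym [curv_op2 T t h1]curv_op2_sym.
  rewrite [curv_op2 T h1 s]curv_op2D [curv_op2 T h1 t]curv_op2D !curv_op2_symprod2 !q11 !q1212.
  have KC x y : K x y = K y x by rewrite /K /q (curv_skew12 TC) (curv_skew34 TC) opprK.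
  by rewrite (KC e2 e1) (KC e3 e1) (KC e4 e1) (KC e3 e2) (KC e4 e2) (KC e4 e3); field.
have qh2 : curv_op2 T h2 h2 = (K e1 e3 + K e2 e4) / 2 - q e1 e2 e3 e4 + q e1 e4 e2 e3.
  rewrite curv_op2_symprod2 !q11 (curv_skew34 TC e1 e2 e4) (curv_skew12 TC e2 e1).
  by rewrite (curv_pair TC e2 e3) /K /q; field.
have q1324 : q e1 e3 e2 e4 = q e1 e2 e3 e4 + q e1 e4 e2 e3.
  have := curv_bianchi TC e1 e2 e3 e4.
  rewrite (curv_pair TC e2 e3) (curv_skew12 TC e3 e1) -!/q => bianchi.
  by rewrite -[LHS]addr0 -bianchi; ring.
have qh3 : curv_op2 T h3 h3 = (K e1 e4 + K e2 e3) / 2 - 2 * q e1 e2 e3 e4 - q e1 e4 e2 e3.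
  rewrite curv_op2_symprod2 !q11 (curv_skew34 TC e2 e1) (curv_skew12 TC e2 e1) opprK.
  by rewrite (curv_pair TC e2 e4) -/q q1324 /K; field.
have qb : curv_op2 T b b = (K e1 e3 + K e2 e4) / 2 + q e1 e2 e3 e4 - q e1 e4 e2 e3.
  rewrite curv_op2_symprod2 !q11 (curv_skew34 TC e1 e2 e4) (curv_skew12 TC e2 e1).
  by rewrite (curv_pair TC e2 e3) /K /q; field.
have q_square x y : curv_op2 T (symprod2 (r / 2) x x (- (r / 2)) y y)
    (symprod2 (r / 2) x x (- (r / 2)) y y) = K x y.
  rewrite curv_op2_symprod2 !q11 !q1212.
  have -> : K y x = K x y by rewrite /K /q (curv_skew12 TC) (curv_skew34 TC) opprK.
  by transitivity (2 * (r * r) * K x y); [field|rewrite rr; field].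
have q_mixed x y : curv_op2 T (symprod2 r x y 0 x y) (symprod2 r x y 0 x y) = K x y.
  rewrite curv_op2_symprod2 !q11 -/q -/(K x y).
  by transitivity (2 * (r * r) * K x y); [ring|rewrite rr; field].
move: I1 I2 I3 I4; rewrite qh1 qh2 qh3 qb /a1 /a2 /a3 /a4 !q_square !q_mixed /trh.
move: (K e1 e2) (K e3 e4) (K e1 e3) (K e1 e4) (K e2 e3) (K e2 e4).
move: (q e1 e2 e3 e4) (q e1 e4 e2 e3).
by clear -R => *; split; lra.
Qed.

Variable J : 'M[R]_n.
Hypothesis JJ : J *m J = - 1%:M.
Hypothesis JJT : J *m J^T = 1%:M.
Hypothesis TJ : forall x y z w, curv_form T x y (z *m J) (w *m J) = curv_form T x y z w.

Lemma frobJ x y : frob (x *m J) (y *m J) = frob x y.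
Proof. by rewrite /frob trmx_mul -!mulmxA mxtrace_mulC -!mulmxA JJT mulmx1. Qed.

Lemma mulJJ x : x *m J *m J = - x.
Proof. by rewrite -mulmxA JJ mulmxN mulmx1. Qed.

Lemma frob_mulJ x : frob x (x *m J) = 0.
Proof.
have := frobJ x (x *m J); rewrite mulJJ -scaleN1r frobZr (frobC (x *m J)); lra.
Qed.

(** Let H1 and H2 be the holomorphic sectional curvatures of u and v, and B
    their bisectional curvature.  The trace over the h_i is
    - (H1 + H2) / 2 - B, and the four inequalities become
    (H1 - H2) / 2 >= B, (H2 - H1) / 2 >= B, B >= (H1 + H2) / 2 and H1 + H2 >= 0.
    The sum of the first two gives B <= 0, so the last two give
    H1 + H2 = B = 0, and the first two give H1 = H2. *)
Lemma holomorphic_sec_eq0_unit u v : k_nonneg_curv_op2 4 T ->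
  frob u u = 1 -> frob v v = 1 -> frob u v = 0 -> frob (u *m J) v = 0 ->
  curv_form T u (u *m J) u (u *m J) = 0.
Proof.
move=> T4 uu vv uv juv.
have ujv : frob u (v *m J) = 0.
  by rewrite -frobJ mulJJ -scaleN1r frobZr juv mulr0.
have four : orthonormal_seq (@frob R 1 n) [:: u; u *m J; v; v *m J].
  have [uJu vJv] := (frob_mulJ u, frob_mulJ v).
  have uJvJ : frob (u *m J) (v *m J) = 0 by rewrite frobJ.
  by move=> [|[|[|[|i]]]] [|[|[|[|j]]]] //= _ _;
    rewrite ?frobJ // frobC ?uv ?juv ?ujv ?uJvJ ?uJu ?vJv.
have [] := four_nonneg_orthonormal T4 four.
have bisec := curv_bisectional TC mulJJ TJ u v.
have K_Ju w : curv_form T (u *m J) w (u *m J) w = curv_form T u (w *m J) u (w *m J).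
  by rewrite -(TJ (u *m J) w) (curvJ1 TC mulJJ TJ) mulJJ (curvN3 TC) opprK.
have ujv_juv : curv_form T u (v *m J) (u *m J) v = - curv_form T u (v *m J) u (v *m J).
  by rewrite -(TJ u (v *m J) (u *m J) v) mulJJ (curvN3 TC).
have K_vJ : curv_form T u (v *m J *m J) u (v *m J *m J) = curv_form T u v u v.
  by rewrite mulJJ (curvN2 TC) (curvN4 TC) opprK.
rewrite !K_Ju K_vJ ujv_juv bisec.
move: (curv_form T u (u *m J) u (u *m J)) (curv_form T v (v *m J) v (v *m J)).
move: (curv_form T u v u v) (curv_form T u (v *m J) u (v *m J)).
by clear -R => *; lra.
Qed.

(** Dimension at least four provides a unit v orthogonal to u and J u, so that
    every holomorphic sectional curvature vanishes. *)
Lemma kahler_curv_op2_flat : (4 <= n)%N -> k_nonneg_curv_op2 4 T ->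
  forall i j k l, T i j k l = 0.
Proof.
move=> n4 T4 i j k l; rewrite -curv_form_delta.
apply: (curv_eq0_of_holomorphic_sec TC _ _ mulJJ TJ) => [x y|x|u].
- by rewrite mulmxDl.
- by rewrite mulNmx.
have [->|u0] := eqVneq u 0.
  by rewrite mul0mx -(scale0r 0) (curv_sec_scale TC) expr0n mul0r.
have uu := frob_pos u0; pose a := Num.sqrt (frob u u).
have a0 : a != 0 by rewrite gt_eqF // sqrtr_gt0.
have aa : a ^+ 2 = frob u u by rewrite sqr_sqrtr // ltW.
pose e := a^-1 *: u.
have ee : frob e e = 1.
  by rewrite frobZ frobZr -aa; field.
have -> : u = a *: e by rewrite /e scalerA mulfV // scale1r.
rewrite -scalemxAl (curv_sec_scale TC).
have eJ : frob e (e *m J) = 0 := frob_mulJ e.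
have oe : orthonormal_seq (@frob R 1 n) [:: e; e *m J].
  by move=> [|[|?]] [|[|?]] //= _ _; rewrite ?frobJ // frobC.
have [t [ot _ tspan]] := orthonormal_completion (@frobD _ _ _) (@frobZ _ _ _) (@frobC _ _ _)
  (@frob_pos _ _ _) (fun _ _ _ (_ : True) (_ : True) => I) oe (fun _ _ => I).
have := orthonormal_basis_size (@frobD _ _ _) (@frobZ _ _ _) (@frobC _ _ _) ot
  (fun x => tspan x I).
rewrite /dim /= mul1n; case: t ot {tspan} => [_ tn|v t ot _].
  by move: (n4); rewrite [X in (_ < X)%N](esym tn).
rewrite (@holomorphic_sec_eq0_unit e v) ?mulr0 //.
- exact: (ot 2%N 2%N isT isT).
- exact: (ot 0%N 2%N isT isT).
- exact: (ot 1%N 2%N isT isT).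
Qed.

End FourNonneg.

(** * Hermitian metrics with closed fundamental form *)
Section HermitianClosed.
Variables (R : realFieldType) (n : nat).
Local Notation E := 'rV[R]_n.
Local Notation e i := (delta_mx 0 i : E).
Implicit Types (d : 'I_n -> 'M[R]_n) (X Y Z : E).

(** Koszul's formula: when d i is the partial derivative of the metric in the
    direction i, the (k, l) entry is the inner product of nabla_i d_k and d_l. *)
Definition koszul d i : 'M[R]_n :=
  \matrix_(k, l) (2^-1 * (d i k l + d k i l - d l i k)).

Definition trilinear d X Y Z : R := (Y *m (\sum_a X 0 a *: d a) *m Z^T) 0 0.

Lemma trilinearE d X Y Z :
  trilinear d X Y Z = \sum_a \sum_b \sum_c X 0 a * Y 0 b * Z 0 c * d a b c.
Proof.
rewrite /trilinear mulmx_sumr mulmx_suml summxE; apply: eq_bigr => a _.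
rewrite -scalemxAr -scalemxAl mxE [X in _ * X]mxE mulr_sumr exchange_big.
apply: eq_bigr => c _; rewrite !mxE mulr_suml mulr_sumr.
by apply: eq_bigr => b _; ring.
Qed.

Lemma sum_delta d i : \sum_a e i 0 a *: d a = d i.
Proof.
rewrite (bigD1 i) //= big1 => [|a /negPf ai]; last by rewrite mxE ai andbF scale0r.
by rewrite mxE !eqxx scale1r addr0.
Qed.

Lemma trilinear_delta d i k l : trilinear d (e i) (e k) (e l) = d i k l.
Proof. by rewrite /trilinear sum_delta -rowE trmx_delta -colE !mxE. Qed.

(** Cyclic identities between components extend to all vectors; this serves for
    closed 2-forms and for the first Bianchi identity. *)
Lemma trilinear_cyclic d : (forall a b c, d a b c + d b c a + d c a b = 0) ->
  forall X Y Z, trilinear d X Y Z + trilinear d Y Z X + trilinear d Z X Y = 0.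
Proof.
move=> d_cyc X Y Z; rewrite !trilinearE.
rewrite [X in _ + X + _](_ : _ = \sum_a \sum_b \sum_c X 0 a * Y 0 b * Z 0 c * d b c a); last first.
  under eq_bigr do rewrite exchange_big /=.
  rewrite exchange_big /=; apply: eq_bigr => a _.
  by apply: eq_bigr => b _; apply: eq_bigr => c _; ring.
rewrite [X in _ + _ + X](_ : _ = \sum_a \sum_b \sum_c X 0 a * Y 0 b * Z 0 c * d c a b); last first.
  rewrite exchange_big /=; apply: eq_bigr => a _; rewrite exchange_big /=.
  by apply: eq_bigr => b _; apply: eq_bigr => c _; ring.
rewrite -!big_split big1 // => a _; rewrite -!big_split big1 // => b _.
rewrite -!big_split big1 // => c _; rewrite /= -!mulrDr d_cyc mulr0 //.
Qed.

Variables (J : 'M[R]_n) (d : 'I_n -> 'M[R]_n).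
Hypothesis JJ : J *m J = - 1%:M.
Hypothesis JT : J^T = - J.
Hypothesis d_sym : forall i, (d i)^T = d i.
Hypothesis d_hermitian : forall i, J *m d i *m J^T = d i.
Hypothesis d_closed : forall a b c,
  (J *m d a) b c + (J *m d b) c a + (J *m d c) a b = 0.

(** The complex structure is parallel: for constant J and omega(Y, Z) = g(J Y, Z),
    Koszul's formula gives
    2 g((nabla_X J) Y, Z) = d omega(X, Y, Z) - d omega(X, J Y, J Z). *)
Lemma koszul_comm i : J *m koszul d i = koszul d i *m J.
Proof.
pose D := trilinear d.
have MT X : (\sum_a X 0 a *: d a)^T = \sum_a X 0 a *: d a.
  by rewrite linear_sum; apply: eq_bigr => a _; rewrite linearZ /= d_sym.
have MJ X : J *m (\sum_a X 0 a *: d a) *m J^T = \sum_a X 0 a *: d a.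
  rewrite mulmx_sumr mulmx_suml; apply: eq_bigr => a _.
  by rewrite -scalemxAr -scalemxAl d_hermitian.
have DC X Y Z : D X Y Z = D X Z Y.
  by rewrite /D /trilinear -{1}(MT X) -{1}(trmxK Y) -!trmx_mul mulmxA mxE.
have DN X Y Z : D X (- Y) Z = - D X Y Z.
  by rewrite /D /trilinear !mulNmx mxE.
have DJ X Y Z : D X (Y *m J) (Z *m J) = D X Y Z.
  by rewrite /D /trilinear trmx_mul -{2}(MJ X) !mulmxA.
have YJJ Y : Y *m J *m J = - Y by rewrite -mulmxA JJ mulmxN mulmx1.
have DJJ X Y Z : D X (Y *m J) Z = - D X Y (Z *m J).
  by rewrite -DJ YJJ DN.
have D_closed X Y Z : D X (Y *m J) Z + D Y (Z *m J) X + D Z (X *m J) Y = 0.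
  have DE X' Y' Z' : D X' (Y' *m J) Z' = trilinear (fun a => J *m d a) X' Y' Z'.
    rewrite /D /trilinear -[Y' *m J *m _]mulmxA mulmx_sumr.
    by congr ((_ *m _ *m _) 0 0); apply: eq_bigr => a _; rewrite -scalemxAr.
  by rewrite !DE; apply: trilinear_cyclic.
have key X Y Z : D X (Y *m J) Z + D (Y *m J) X Z - D Z X (Y *m J)
    + (D X Y (Z *m J) + D Y X (Z *m J) - D (Z *m J) X Y) = 0.
  have := D_closed X Y Z; have := D_closed X (Y *m J) (Z *m J).
  rewrite !YJJ !DN (DJJ Z X Y) (DC Y (Z *m J)) DJ (DC (Y *m J) Z); lra.
have D1 X Y Z : D X Y Z = \sum_s X 0 s * D (e s) Y Z.
  rewrite /D {1}/trilinear mulmx_sumr mulmx_suml summxE; apply: eq_bigr => s _.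
  by rewrite -scalemxAr -scalemxAl mxE /trilinear sum_delta.
have D2 X Y Z : D X Y Z = \sum_s Y 0 s * D X (e s) Z.
  rewrite /D {1}/trilinear {1}(row_sum_delta Y) !mulmx_suml summxE; apply: eq_bigr => s _.
  by rewrite -!scalemxAl mxE.
have D3 X Y Z : D X Y Z = \sum_s Z 0 s * D X Y (e s).
  by rewrite DC D2; apply: eq_bigr => s _; rewrite DC.
have eJ k s : (e k *m J) 0 s = J k s by rewrite -rowE mxE.
have J_koszul k l : (J *m koszul d i) k l =
    2^-1 * (D (e i) (e k *m J) (e l) + D (e k *m J) (e i) (e l) - D (e l) (e i) (e k *m J)).
  rewrite (D2 (e i)) (D1 (e k *m J)) (D3 (e l)) -big_split -sumrB mulr_sumr mxE.
  by apply: eq_bigr => s _; rewrite eJ /D !trilinear_delta mxE /=; ring.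
have koszul_J k l : (koszul d i *m J) k l =
    - (2^-1 * (D (e i) (e k) (e l *m J) + D (e k) (e i) (e l *m J) - D (e l *m J) (e i) (e k))).
  rewrite (D3 (e i)) (D3 (e k)) (D1 (e l *m J)) -big_split -sumrB mulr_sumr mxE -sumrN.
  apply: eq_bigr => s _; rewrite eJ /D !trilinear_delta mxE /=.
  have -> : J s l = - J l s by rewrite -[in LHS](trmxK J) JT !mxE.
  by ring.
apply/matrixP => k l; rewrite J_koszul koszul_J; have := key (e i) (e k) (e l); lra.
Qed.
End HermitianClosed.

(** * Symmetry of second derivatives *)
Local Open Scope classical_set_scope.

Section Schwarz.
Variables (R : realType) (V : normedModType R).
Implicit Types (f : V -> R) (x u v : V).

Lemma differentiable_expansion f x : differentiable f x ->
  forall e, 0 < e -> exists2 d, 0 < d &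
    forall k, `|k| < d -> `|f (k + x) - f x - 'D_k f x| <= e * `|k|.
Proof.
move=> df e e0.
have [rest restE] : exists rest : {o_(nbhs (0 : V)) id},
    forall k, f (k + x) = f x + 'd f x k + rest k.
  have := diff_locally df; set rest := the_littleo _ _ _ _ _ => E.
  by exists rest => k; have := congr1 (fun g => g k) E.
have /nbhs_ballP[d /= d0 dP] := littleoP rest e0.
exists d => // k kd; rewrite deriveE // restE.
have -> : f x + 'd f x k + rest k - f x - 'd f x k = rest k by ring.
by apply: dP; rewrite -ball_normE /ball_ /= sub0r normrN.
Qed.

Lemma is_derive_line f x u (t : R) : differentiable f (x + t *: u) ->
  is_derive t (1 : R) (fun s => f (x + s *: u)) ('D_u f (x + t *: u)).
Proof.
move=> df.
have E : (fun h : R => h^-1 *: (f (x + (h *: (1 : R) + t) *: u) - f (x + t *: u))) =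
         (fun h : R => h^-1 *: (f (h *: u + (x + t *: u)) - f (x + t *: u))).
  apply/funext => h; congr (_ *: (f _ - _)).
  by rewrite [h *: 1]mulr1 scalerDl addrCA.
split; last by rewrite /derive E.
by rewrite /derivable E; apply: diff_derivable.
Qed.

(** The second difference along h u and h v is the increment of
    t |-> f (x + h v + t u) - f (x + t u) on [0, h].  By the mean value theorem it
    is h times the difference of two values of 'D_u f, which the expansion of
    'D_u f at x gives up to o(h). *)
Lemma second_difference_derive f x u v :
  (\forall y \near x, differentiable f y) -> differentiable ('D_u f) x ->
  forall e, 0 < e -> exists2 d, 0 < d & forall h, 0 < h < d ->
    `|f (x + h *: v + h *: u) - f (x + h *: v) - f (x + h *: u) + f x
      - h ^+ 2 * 'D_v ('D_u f) x| <= e * h ^+ 2.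
Proof.
move=> nf dDu e e0.
have /nbhs_ballP[d1 /= d10 d1P] := nf.
(* all points met below are at distance less than h * C from x *)
pose C := `|u| + `|v| + 1.
have C0 : 0 < C by rewrite /C ltr_wpDl // addr_ge0.
have [d2 d20 d2P] := differentiable_expansion dDu (divr_gt0 e0 (mulr_gt0 (ltr0n R 2 : 0 < 2) C0)).
exists (Num.min d1 d2 / C) => [|h /andP[h0 hd]].
  by rewrite divr_gt0 // lt_min d10.
have hC : h * C < Num.min d1 d2 by rewrite -ltr_pdivlMr.
have small s w : 0 <= s <= h -> `|w| <= h * `|v| -> `|s *: u + w| < Num.min d1 d2.
  move=> /andP[s0 sh] wv; apply: le_lt_trans hC; apply: le_trans (ler_normD _ _) _.
  rewrite normrZ ger0_norm // /C !mulrDr mulr1 -addrA lerD //.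
    by rewrite ler_wpM2r.
  by rewrite (le_trans wv) // lerDl ltW.
have hv0 : `|0 : V| <= h * `|v| by rewrite normr0 mulr_ge0 // ltW.
have hvv : `|h *: v| <= h * `|v| by rewrite normrZ ger0_norm // ltW.
have dfs s w : 0 <= s <= h -> `|w| <= h * `|v| -> differentiable f (x + w + s *: u).
  move=> sh wv; apply: d1P; rewrite -ball_normE /ball_ /=.
  have -> : x - (x + w + s *: u) = - (s *: u + w) by rewrite -addrA opprD addNKr addrC.
  by rewrite normrN (lt_le_trans (small _ _ sh wv)) // ge_min lexx.
pose phi s := f (x + h *: v + s *: u) - f (x + 0 + s *: u).
pose dphi s := 'D_u f (x + h *: v + s *: u) - 'D_u f (x + 0 + s *: u).
have phi_derive s : 0 <= s <= h -> is_derive s (1 : R) phi (dphi s).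
  by move=> sh; apply: is_deriveB; apply: is_derive_line; apply: dfs.
have [||c /andP[c0 ch] phiE] := @MVT R phi dphi 0 h h0.
- by move=> s; rewrite in_itv /= => /andP[s0 sh]; apply: phi_derive; rewrite !ltW.
- apply: derivable_within_continuous => s; rewrite in_itv /= => sh.
  by have [] := phi_derive s sh.
have csh : 0 <= c <= h by rewrite !ltW.
have L0 := d2P (c *: u + h *: v); have L1 := d2P (c *: u).
have bnd w : `|w| <= h * `|v| -> `|c *: u + w| < d2.
  by move=> wv; rewrite (lt_le_trans (small _ _ csh wv)) // ge_min lexx orbT.
have {}L0 := L0 (bnd _ hvv).
have {}L1 : `|'D_u f (c *: u + x) - 'D_u f x - 'D_(c *: u) ('D_u f) x| <=
    e / (2 * C) * `|c *: u|.
  by apply: L1; have := bnd _ hv0; rewrite addr0.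
have DE w : 'D_w ('D_u f) x = 'd ('D_u f) x w by rewrite deriveE.
have -> : f (x + h *: v + h *: u) - f (x + h *: v) - f (x + h *: u) + f x = dphi c * h.
  by rewrite -[h in dphi c * h]subr0 -phiE /phi addr0 scale0r !addr0; ring.
have -> : dphi c * h - h ^+ 2 * 'D_v ('D_u f) x =
   h * (('D_u f (c *: u + h *: v + x) - 'D_u f x - 'D_(c *: u + h *: v) ('D_u f) x)
      - ('D_u f (c *: u + x) - 'D_u f x - 'D_(c *: u) ('D_u f) x)).
  have dZ : 'd ('D_u f) x (h *: v) = h * 'd ('D_u f) x v by exact: linearZ.
  have -> : c *: u + h *: v + x = x + h *: v + c *: u by rewrite addrC addrA addrAC.
  rewrite !DE linearD /= dZ /dphi addr0 (addrC (c *: u) x); ring.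
rewrite normrM (gtr0_norm h0) expr2 mulrCA ler_pM2l //.
apply: le_trans (ler_normB _ _) _.
apply: le_trans (lerD L0 L1) _.
rewrite -mulrDr mulrAC ler_pdivrMr ?mulr_gt0 // -mulrA ler_pM2l //.
have cu : `|c *: u| <= h * `|u|.
  by case/andP: csh => c0' ch'; rewrite normrZ ger0_norm // ler_wpM2r.
have := ler_normD (c *: u) (h *: v).
have hv_ge0 : 0 <= h * `|v| by rewrite mulr_ge0 // ltW.
move: cu hvv h0 hv_ge0; rewrite /C.
move: `|c *: u + h *: v| `|c *: u| `|h *: v| `|u| `|v|; clear => *; lra.
Qed.

(** Young's theorem: both iterated derivatives are the limit of the second
    difference divided by h ^+ 2, and the second difference is symmetric in u
    and v. *)
Lemma derive_comm f x u v : (\forall y \near x, differentiable f y) ->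
  differentiable ('D_u f) x -> differentiable ('D_v f) x ->
  'D_v ('D_u f) x = 'D_u ('D_v f) x.
Proof.
move=> nf du dv; apply/eqP; rewrite -subr_eq0 -normr_le0; apply/ler_addgt0Pl => e e0.
have e20 : 0 < e / 2 by rewrite divr_gt0.
have [d1 d10 H1] := second_difference_derive v nf du e20.
have [d2 d20 H2] := second_difference_derive u nf dv e20.
pose h := Num.min d1 d2 / 2.
have h0 : 0 < h by rewrite divr_gt0 // lt_min d10.
have hm : h < Num.min d1 d2 by rewrite ltr_pdivrMr // mulr_natr mulr2n ltrDl lt_min d10.
move: hm; rewrite lt_min => /andP[h1 h2].
have {}H1 := H1 h; have {}H2 := H2 h; rewrite h0 h1 in H1; rewrite h0 h2 in H2.
have {}H1 := H1 isT; have {}H2 := H2 isT.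
have hh : 0 < h ^+ 2 by rewrite exprn_gt0.
rewrite addr0 -(ler_pM2l hh) -[h ^+ 2 in X in X <= _](gtr0_norm hh) -normrM.
rewrite (addrAC x (h *: u)) in H2.
set A := f (x + h *: v + h *: u) in H1 H2; set a := f (x + h *: v) in H1 H2.
set b := f (x + h *: u) in H1 H2; set z := f x in H1 H2.
set X := 'D_v _ x in H1 *; set Y := 'D_u _ x in H2 *.
have -> : h ^+ 2 * (X - Y) = (A - b - a + z - h ^+ 2 * Y) - (A - a - b + z - h ^+ 2 * X) by ring.
apply: le_trans (ler_normB _ _) _; apply: le_trans (lerD H2 H1) _.
by rewrite -mulrDl -splitr mulrC.
Qed.

End Schwarz.

(** * Entrywise derivatives of matrices *)
HB.lock Definition mx_derive (R : realType) (n p q : nat) (u : 'rV[R]_n)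
    (F : 'rV[R]_n -> 'M[R]_(p, q)) (x : 'rV[R]_n) : 'M[R]_(p, q) :=
  \matrix_(a, b) 'D_u (fun y => F y a b) x.

Section MatrixCalculus.
Variables (R : realType) (n : nat).
Local Notation E := 'rV[R]_n.
Implicit Types (f : E -> R) (x : E) (i : 'I_n).

Implicit Types u : E.

Lemma derivable_bigsum (I : Type) (r : seq I) (P : pred I) (f : I -> E -> R) x u :
  (forall k, derivable (f k) x u) ->
  derivable (fun y => \sum_(k <- r | P k) f k y) x u.
Proof.
move=> df; elim: r => [|k r IH].
  by under eq_fun do rewrite big_nil; exact: derivable_cst.
under eq_fun do rewrite big_cons; case: (P k); [exact: (derivableD (df k) IH)|exact: IH].
Qed.

Lemma derivable_bigprod (I : Type) (r : seq I) (P : pred I) (f : I -> E -> R) x u :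
  (forall k, derivable (f k) x u) ->
  derivable (fun y => \prod_(k <- r | P k) f k y) x u.
Proof.
move=> df; elim: r => [|k r IH].
  by under eq_fun do rewrite big_nil; exact: derivable_cst.
under eq_fun do rewrite big_cons; case: (P k); [exact: (derivableM (df k) IH)|exact: IH].
Qed.

Lemma derive_bigsum (I : Type) (r : seq I) (f : I -> E -> R) x u :
  (forall k, derivable (f k) x u) ->
  'D_u (fun y => \sum_(k <- r) f k y) x = \sum_(k <- r) 'D_u (f k) x.
Proof.
move=> df; elim: r => [|k r IH].
  rewrite big_nil; under eq_fun do rewrite big_nil; exact: derive_cst.
rewrite big_cons -IH; under eq_fun do rewrite big_cons.
by apply: deriveD => //; exact: derivable_bigsum.
Qed.

Definition mx_derivable p q (F : E -> 'M[R]_(p, q)) x u :=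
  forall a b, derivable (fun y => F y a b) x u.

Lemma mx_deriveE p q u (F : E -> 'M[R]_(p, q)) x a b :
  mx_derive u F x a b = 'D_u (fun y => F y a b) x.
Proof. by rewrite mx_derive.unlock [LHS]mxE. Qed.

Lemma mx_derivable_mul p q r (F : E -> 'M[R]_(p, q)) (G : E -> 'M[R]_(q, r)) x u :
  mx_derivable F x u -> mx_derivable G x u ->
  mx_derivable (fun y => F y *m G y) x u.
Proof.
move=> dF dG a b; under eq_fun do rewrite mxE.
by apply: derivable_bigsum => k; apply: derivableM.
Qed.

Lemma mx_derive_mul p q r (F : E -> 'M[R]_(p, q)) (G : E -> 'M[R]_(q, r)) x u :
  mx_derivable F x u -> mx_derivable G x u ->
  mx_derive u (fun y => F y *m G y) x =
  mx_derive u F x *m G x + F x *m mx_derive u G x.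
Proof.
move=> dF dG; apply/matrixP => a b.
rewrite mx_deriveE [RHS]mxE [X in _ = X + _]mxE [X in _ = _ + X]mxE -big_split /=.
transitivity ('D_u (fun y => \sum_k F y a k * G y k b) x).
  by congr ('D_u _ x); apply/funext => y; rewrite mxE.
rewrite derive_bigsum => [|k]; last exact: derivableM.
apply: eq_bigr => k _; rewrite !mx_deriveE.
rewrite [LHS](deriveM (dF a k) (dG k b)) addrC; congr (_ + _); exact: mulrC.
Qed.

Lemma mx_derivable_near p q (F G : E -> 'M[R]_(p, q)) x u :
  (\forall y \near x, F y = G y) -> mx_derivable F x u -> mx_derivable G x u.
Proof.
move=> FG dF a b; apply: near_eq_derivable (dF a b).
by apply: filterS FG => y ->.
Qed.

Lemma mx_derive_near p q (F G : E -> 'M[R]_(p, q)) x u :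
  (\forall y \near x, F y = G y) -> mx_derive u F x = mx_derive u G x.
Proof.
move=> FG; apply/matrixP => a b; rewrite !mx_deriveE; apply: near_eq_derive.
by apply: filterS FG => y ->.
Qed.

Lemma mx_derivable_tr p q (F : E -> 'M[R]_(p, q)) x u :
  mx_derivable F x u -> mx_derivable (fun y => (F y)^T) x u.
Proof.
move=> dF a b; rewrite (_ : (fun y => _) = (fun y => F y b a)) //.
by apply/funext => y; rewrite mxE.
Qed.

Lemma mx_derive_tr p q (F : E -> 'M[R]_(p, q)) x u :
  mx_derive u (fun y => (F y)^T) x = (mx_derive u F x)^T.
Proof.
by apply/matrixP => a b; rewrite mxE !mx_deriveE; congr ('D_u _ x); apply/funext => y; rewrite mxE.
Qed.

Lemma mx_derivable_cst p q (A : 'M[R]_(p, q)) x u : mx_derivable (cst A) x u.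
Proof. by move=> a b; exact: (derivable_cst (A a b)). Qed.

Lemma mx_derive_cst p q (A : 'M[R]_(p, q)) x u : mx_derive u (cst A) x = 0.
Proof. by apply/matrixP => a b; rewrite mx_deriveE mxE; exact: (derive_cst (A a b)). Qed.

Lemma mx_derive_add p q (F G : E -> 'M[R]_(p, q)) x u :
  mx_derivable F x u -> mx_derivable G x u ->
  mx_derive u (fun y => F y + G y) x = mx_derive u F x + mx_derive u G x.
Proof.
move=> dF dG; apply/matrixP => a b; rewrite mxE !mx_deriveE -(deriveD (dF a b) (dG a b)).
by congr ('D_u _ x); apply/funext => y; rewrite mxE.
Qed.

Lemma mx_derive_mull p q r (A : 'M[R]_(p, q)) (F : E -> 'M[R]_(q, r)) x u :
  mx_derivable F x u ->
  mx_derive u (fun y => A *m F y) x = A *m mx_derive u F x.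
Proof.
move=> dF; rewrite (@mx_derive_mul _ _ _ (cst A) _ _ _ (@mx_derivable_cst _ _ A x u) dF).
by rewrite mx_derive_cst mul0mx add0r.
Qed.

Lemma mx_derive_mulr p q r (A : 'M[R]_(q, r)) (F : E -> 'M[R]_(p, q)) x u :
  mx_derivable F x u ->
  mx_derive u (fun y => F y *m A) x = mx_derive u F x *m A.
Proof.
move=> dF; rewrite (@mx_derive_mul _ _ _ _ (cst A) _ _ dF (@mx_derivable_cst _ _ A x u)).
by rewrite mx_derive_cst mulmx0 addr0.
Qed.

Lemma derivable_det p (F : E -> 'M[R]_p) x u :
  mx_derivable F x u -> derivable (fun y => \det (F y)) x u.
Proof.
move=> dF; apply: derivable_bigsum => s.
apply: (derivableM (derivable_cst _ _ _)).
by apply: derivable_bigprod => k; exact: dF.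
Qed.

(** Near x the inverse is the adjugate divided by the determinant. *)
Lemma mx_derivable_inv p (F : E -> 'M[R]_p) x u :
  mx_derivable F x u -> (\forall y \near x, F y \in unitmx) ->
  mx_derivable (fun y => invmx (F y)) x u.
Proof.
move=> dF uF.
apply: (@mx_derivable_near _ _ (fun y => (\det (F y))^-1 *: \adj (F y))).
  by apply: filterS uF => y uFy; rewrite /invmx uFy.
move=> a b.
rewrite (_ : (fun y => _) = (fun y => (\det (F y))^-1) * (fun y => cofactor (F y) b a)).
  apply: derivableM.
    apply: derivableV; last exact: derivable_det.
    by have := nbhs_singleton uF; rewrite unitmxE unitfE.
  apply: (derivableM (derivable_cst _ _ _)); apply: derivable_det => c e.
  rewrite (_ : (fun y => _) = (fun y => F y (lift b c) (lift a e))); first exact: dF.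
  by apply/funext => y; rewrite !mxE.
by apply/funext => y; rewrite !mxE.
Qed.

End MatrixCalculus.

(** * The Levi-Civita connection in coordinates *)

(** Here X and Y are the connection matrices in two directions, C and A the
    derivatives of X and Y in the other direction, and the equation says that the
    second derivatives of g commute when its first derivatives are given by
    metric compatibility. *)
Lemma curvature_skew_algebra (R : realFieldType) n (g A C X Y : 'M[R]_n) : g^T = g ->
  C *m g + X *m (Y *m g + g *m Y^T) + ((Y *m g + g *m Y^T) *m X^T + g *m C^T) =
  A *m g + Y *m (X *m g + g *m X^T) + ((X *m g + g *m X^T) *m Y^T + g *m A^T) ->
  ((A - C + Y *m X - X *m Y) *m g)^T = - ((A - C + Y *m X - X *m Y) *m g).
Proof.
have addE (M N : 'M[R]_n) a b : (M + N) a b = M a b + N a b by rewrite mxE.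
have oppE (M : 'M[R]_n) a b : (- M) a b = - M a b by rewrite mxE.
have trD (M N : 'M[R]_n) : (M + N)^T = M^T + N^T by apply/matrixP => a b; rewrite !mxE.
have trN (M : 'M[R]_n) : (- M)^T = - M^T by apply/matrixP => a b; rewrite !mxE.
move=> g_sym; rewrite trmx_mul g_sym !(trD, trN, trmx_mul).
rewrite !(mulmxDl, mulmxDr, mulNmx, mulmxN, mulmxA) => /matrixP comm.
by apply/matrixP => a b; have := comm a b; rewrite !(addE, oppE); lra.
Qed.

Section LeviCivita.
Variables (R : realType) (n : nat).
Local Notation E := 'rV[R]_n.
Variables (g : E -> 'M[R]_n) (U : set E).
Hypothesis U_open : open U.
Hypothesis g_smooth : forall a b, smooth_on U (fun x => g x a b).
Hypothesis g_sym : forall x, U x -> (g x)^T = g x.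
Hypothesis g_unit : forall x, U x -> g x \in unitmx.
Local Notation e i := (delta_mx 0 i : E).

Let near_U x : U x -> \forall y \near x, U y.
Proof. by move=> Ux; apply: open_nbhs_nbhs. Qed.

Definition dmetric i x := mx_derive (e i) g x.

Lemma dmetricE i x a b : dmetric i x a b = pderiv i (fun y => g y a b) x.
Proof. exact: mx_deriveE. Qed.

Definition lowered_christoffel i x : 'M[R]_n := koszul (fun k => dmetric k x) i.

(** The covariant derivative in the direction i of the coordinate fields: row k
    holds the components of nabla_i d_k.  Matrices act on row vectors from the
    right. *)
Definition christoffel_mx i x : 'M[R]_n := \matrix_(k, l) christoffel g l i k x.

Lemma christoffel_mxE i x :
  christoffel_mx i x = lowered_christoffel i x *m (invmx (g x))^T.
Proof.
apply/matrixP => k l; rewrite [LHS]mxE [RHS]mxE /christoffel mulr_sumr.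
apply: eq_bigr => s _; rewrite [lowered_christoffel _ _ _ _]mxE [_^T _ _]mxE mulrCA [RHS]mulrC.
by congr (_ * (_ * (_ + _ - _))); rewrite dmetricE.
Qed.

Lemma christoffel_mx_metric i x : U x ->
  christoffel_mx i x *m g x = lowered_christoffel i x.
Proof. by move=> Ux; rewrite christoffel_mxE trmx_inv g_sym // mulmxKV // g_unit. Qed.

Lemma dmetric_sym i x : U x -> (dmetric i x)^T = dmetric i x.
Proof.
by move=> Ux; rewrite -mx_derive_tr; apply: mx_derive_near; apply: filterS (near_U Ux) => y /g_sym.
Qed.

(** nabla g = 0: when Koszul's formula is symmetrised in its last two indices,
    only the derivative in the direction i survives. *)
Lemma metric_compatible i x : U x ->
  dmetric i x = christoffel_mx i x *m g x + g x *m (christoffel_mx i x)^T.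
Proof.
move=> Ux; rewrite -{2}(g_sym Ux) -trmx_mul christoffel_mx_metric //.
apply/matrixP => k l; rewrite [RHS]mxE [X in _ = _ + X]mxE ![lowered_christoffel _ _ _ _]mxE.
have -> : dmetric i x l k = dmetric i x k l by rewrite -{2}(dmetric_sym i Ux) [RHS]mxE.
by field.
Qed.

Lemma dmetric_derivable i x u : U x -> mx_derivable (dmetric i) x u.
Proof.
move=> Ux a b; rewrite (_ : (fun y => _) = pderiv i (fun y => g y a b)).
  exact/diff_derivable/(g_smooth a b [:: i]).
by apply/funext => y; rewrite dmetricE.
Qed.

Lemma metric_derivable x u : U x -> mx_derivable g x u.
Proof. by move=> Ux a b; exact/diff_derivable/(g_smooth a b [::]). Qed.

Lemma christoffel_mx_derivable i x u : U x -> mx_derivable (christoffel_mx i) x u.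
Proof.
move=> Ux; rewrite (_ : christoffel_mx i = fun y => lowered_christoffel i y *m (invmx (g y))^T).
  apply: mx_derivable_mul; last first.
    apply/mx_derivable_tr/mx_derivable_inv; first exact: metric_derivable.
    by apply: filterS (near_U Ux); exact: g_unit.
  move=> k l; rewrite (_ : (fun y => _) = cst 2^-1 * ((fun y => dmetric i y k l) +
    (fun y => dmetric k y i l) - (fun y => dmetric l y i k))).
    apply: (derivableM (derivable_cst _ _ _)); apply: derivableB; last exact: dmetric_derivable.
    by apply: derivableD; exact: dmetric_derivable.
  by apply/funext => y; rewrite mxE.
by apply/funext => y; exact: christoffel_mxE.
Qed.

Lemma second_dmetric_comm i j x : U x ->
  mx_derive (e j) (dmetric i) x = mx_derive (e i) (dmetric j) x.
Proof.
move=> Ux; apply/matrixP => a b; rewrite !mx_deriveE.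
have dmetric_fun k : (fun y => dmetric k y a b) = 'D_(e k) (fun y => g y a b).
  by apply/funext => y; rewrite dmetricE.
rewrite !dmetric_fun.
apply: derive_comm.
- by apply: filterS (near_U Ux) => y Uy; exact: (g_smooth a b [::]).
- exact: (g_smooth a b [:: i]).
- exact: (g_smooth a b [:: j]).
Qed.

(** The endomorphism R(d_i, d_j).  The order of the products is reversed by the
    action on row vectors. *)
Definition curvature_mx i j x : 'M[R]_n :=
  mx_derive (e i) (christoffel_mx j) x - mx_derive (e j) (christoffel_mx i) x
  + christoffel_mx j x *m christoffel_mx i x - christoffel_mx i x *m christoffel_mx j x.

Lemma curv_endoE x i j k l : curv_endo g x i j k l = curvature_mx i j x k l.
Proof.
have christoffel_fun p : christoffel g l p k = fun y => christoffel_mx p y k l.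
  by apply/funext => y; rewrite [RHS]mxE.
rewrite /curv_endo sumrB addrA /pderiv !christoffel_fun -!mx_deriveE.
rewrite [RHS]mxE [X in _ = X + _]mxE [X in _ = X + _ + _]mxE; congr (_ + _ + _ + _).
- by rewrite [RHS]mxE.
- by rewrite [RHS]mxE; apply: eq_bigr => s _; rewrite mulrC ![christoffel_mx _ _ _ _]mxE.
- rewrite [RHS]mxE [in RHS]mxE; congr (- _); apply: eq_bigr => s _.
  by rewrite mulrC ![christoffel_mx _ _ _ _]mxE.
Qed.

Lemma riemannE x i j k l : riemann g x i j k l = (curvature_mx i j x *m g x) l k.
Proof. by rewrite mxE; apply: eq_bigr => s _; rewrite curv_endoE. Qed.

Lemma curvature_mxC i j x : curvature_mx j i x = - curvature_mx i j x.
Proof. by rewrite /curvature_mx !opprD !opprK addrAC [X in X - _ + _]addrC. Qed.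

(** R(d_i, d_j) is skew-adjoint: differentiate metric compatibility once more
    and use the symmetry of the second derivatives of g. *)
Lemma curvature_mx_skew i j x : U x ->
  (curvature_mx i j x *m g x)^T = - (curvature_mx i j x *m g x).
Proof.
move=> Ux; pose G := christoffel_mx.
have dd a b : mx_derive (e b) (dmetric a) x =
    mx_derive (e b) (G a) x *m g x + G a x *m dmetric b x
    + (dmetric b x *m (G a x)^T + g x *m (mx_derive (e b) (G a) x)^T).
  transitivity (mx_derive (e b) (fun y => G a y *m g y + g y *m (G a y)^T) x).
    by apply: mx_derive_near; apply: filterS (near_U Ux) => y /(metric_compatible a).
  have [dG dg] := (@christoffel_mx_derivable a x (e b) Ux, @metric_derivable x (e b) Ux).
  have dGT := mx_derivable_tr dG.
  rewrite (mx_derive_add (mx_derivable_mul dG dg) (mx_derivable_mul dg dGT)).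
  by rewrite (mx_derive_mul dG dg) (mx_derive_mul dg dGT) mx_derive_tr.
apply: curvature_skew_algebra; first exact: g_sym.
by rewrite -!(metric_compatible _ Ux) -!dd; exact: second_dmetric_comm.
Qed.

Lemma christoffel_symmetric i j k x : U x -> christoffel g k i j x = christoffel g k j i x.
Proof.
move=> Ux; rewrite /christoffel; congr (_ * _); apply: eq_bigr => l _.
have gij : pderiv l (fun y => g y i j) x = pderiv l (fun y => g y j i) x.
  by rewrite -!dmetricE -{1}(dmetric_sym l Ux) mxE.
by rewrite gij [X in _ * (X - _)]addrC.
Qed.

(** The first Bianchi identity is a formal consequence of the symmetry of the
    Christoffel symbols. *)
Lemma curv_endo_bianchi i j k l x : U x ->
  curv_endo g x i j k l + curv_endo g x j k i l + curv_endo g x k i j l = 0.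
Proof.
have cyclic (a b c s t u : R) :
    a - b + (s - t) + (b - c + (t - u)) + (c - a + (u - s)) = 0 by ring.
move=> Ux.
have dC p q r : pderiv p (christoffel g l q r) x = pderiv p (christoffel g l r q) x.
  by apply: near_eq_derive; apply: filterS (near_U Ux) => y; exact: christoffel_symmetric.
pose S p q r := \sum_s christoffel g l p s x * christoffel g s q r x.
have SC p q r : S p q r = S p r q.
  by apply: eq_bigr => s _; rewrite (christoffel_symmetric q).
have endoE p q r : curv_endo g x p q r l = pderiv p (christoffel g l q r) x
    - pderiv q (christoffel g l p r) x + (S p q r - S q p r).
  by rewrite /curv_endo sumrB.
rewrite !endoE (dC i k j) (dC j i k) (dC k j i) (SC i k j) (SC j i k) (SC k j i).
exact: cyclic.
Qed.


Variable J : 'M[R]_n.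
Hypothesis JJ : J *m J = - 1%:M.
Hypothesis JT : J^T = - J.
Hypothesis g_hermitian : forall x, U x -> J *m g x *m J^T = g x.
Hypothesis g_closed : forall x a b c, U x ->
  pderiv a (fun y => (J *m g y) b c) x + pderiv b (fun y => (J *m g y) c a) x
  + pderiv c (fun y => (J *m g y) a b) x = 0.

Lemma dmetric_hermitian i x : U x -> J *m dmetric i x *m J^T = dmetric i x.
Proof.
move=> Ux; have dg := @metric_derivable x (e i) Ux.
have dJg := mx_derivable_mul (@mx_derivable_cst _ _ _ _ J x (e i)) dg.
rewrite /dmetric -(mx_derive_mull J dg) -(mx_derive_mulr J^T dJg).
by apply: mx_derive_near; apply: filterS (near_U Ux) => y; exact: g_hermitian.
Qed.

Lemma dmetric_closed a b c x : U x ->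
  (J *m dmetric a x) b c + (J *m dmetric b x) c a + (J *m dmetric c x) a b = 0.
Proof.
move=> Ux; have dg i := @metric_derivable x (e i) Ux.
by rewrite -!(mx_derive_mull J (dg _)) !mx_deriveE; exact: g_closed.
Qed.

Lemma metric_comm x : U x -> J *m g x = g x *m J.
Proof.
move=> Ux; rewrite -[in RHS](g_hermitian Ux) -mulmxA JT mulNmx JJ opprK mulmx1 //.
Qed.

(** nabla J = 0, the lowered version of which is koszul_comm. *)
Lemma christoffel_mx_comm i x : U x ->
  J *m christoffel_mx i x = christoffel_mx i x *m J.
Proof.
move=> Ux.
have : J *m lowered_christoffel i x = lowered_christoffel i x *m J.
  apply: koszul_comm => // [k|k|a b c]; [exact: dmetric_sym|exact: dmetric_hermitian|].
  exact: dmetric_closed.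
rewrite -(christoffel_mx_metric i Ux) -mulmxA -metric_comm // !mulmxA.
by move/(congr1 (mulmx^~ (invmx (g x)))); rewrite !mulmxK // g_unit.
Qed.

(** As J is constant in the chart, J commutes with the derivatives of the
    connection matrices as well as with their products. *)
Lemma curvature_mx_comm i j x : U x -> J *m curvature_mx i j x = curvature_mx i j x *m J.
Proof.
move=> Ux.
have dcomm p q : J *m mx_derive (e p) (christoffel_mx q) x =
    mx_derive (e p) (christoffel_mx q) x *m J.
  have dG := @christoffel_mx_derivable q x (e p) Ux.
  rewrite -mx_derive_mull // -mx_derive_mulr //.
  by apply: mx_derive_near; apply: filterS (near_U Ux) => y; exact: christoffel_mx_comm.
have pcomm p q : J *m (christoffel_mx p x *m christoffel_mx q x) =
    christoffel_mx p x *m christoffel_mx q x *m J.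
  by rewrite mulmxA christoffel_mx_comm // -!mulmxA christoffel_mx_comm.
rewrite /curvature_mx mulmxBr mulmxDr mulmxBr !dcomm !pcomm.
by rewrite mulmxBl mulmxDl mulmxBl.
Qed.

End LeviCivita.

(** * From the coordinate curvature to the curvature form in a frame *)
Section TensorForm.
Variables (R : realType) (n : nat).
Local Notation E := 'rV[R]_n.
Implicit Types (T : tensor4 R n) (x y z w : E).

Lemma curv_form_lin T a x x' y z w :
  curv_form T (a *: x + x') y z w = a * curv_form T x y z w + curv_form T x' y z w.
Proof. by rewrite /curv_form linearD linearZ /= mulmxDl -scalemxAl curv_op2D curv_op2Z. Qed.

Lemma tensor_curvature_like T :
  (forall i j k l, T i j k l = - T j i k l) ->
  (forall i j k l, T i j k l = - T i j l k) ->
  (forall i j k l, T i j k l + T j k i l + T k i j l = 0) ->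
  curvature_like (curv_form T).
Proof.
move=> T12 T34 TB; split; first exact: curv_form_lin.
- move=> x y z w; rewrite !curv_formE [in RHS]exchange_big -sumrN; apply: eq_bigr => i _.
  rewrite -sumrN; apply: eq_bigr => j _; rewrite -sumrN; apply: eq_bigr => k _.
  by rewrite -sumrN; apply: eq_bigr => l _; rewrite T12; ring.
- move=> x y z w; rewrite !curv_formE -sumrN; apply: eq_bigr => i _.
  rewrite -sumrN; apply: eq_bigr => j _; rewrite [in RHS]exchange_big -sumrN.
  apply: eq_bigr => k _.
  by rewrite -sumrN; apply: eq_bigr => l _; rewrite T34; ring.
- move=> x y z w.
  pose d (a : 'I_n) := \matrix_(b, c) \sum_l T a b c l * w 0 l.
  have formE x' y' z' : curv_form T x' y' z' w = trilinear d x' y' z'.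
    rewrite curv_formE trilinearE; apply: eq_bigr => a _; apply: eq_bigr => b _.
    by apply: eq_bigr => c _; rewrite mxE mulr_sumr; apply: eq_bigr => l _; ring.
  rewrite !formE; apply: trilinear_cyclic => a b c; rewrite !mxE -!big_split big1 //= => l _.
  by rewrite -!mulrDl TB mul0r.
Qed.

Lemma curv_form_riemann g p x y z w :
  curv_form (riemann g p) x y z w = \sum_i \sum_j
    x 0 i * y 0 j * (w *m (curvature_mx g i j p *m g p) *m z^T) 0 0.
Proof.
rewrite curv_formE; apply: eq_bigr => i _; apply: eq_bigr => j _.
rewrite mxE mulr_sumr; apply: eq_bigr => k _; rewrite mxE mulr_suml mulr_sumr.
by apply: eq_bigr => l _; rewrite riemannE !mxE; ring.
Qed.

(** Expand the rows of x B, y B, z B, w B along the rows of B, one argument at a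
    time. *)
Lemma curv_form_frame g p B x y z w : curvature_like (curv_form (riemann g p)) ->
  curv_form (riemann_in_frame g p B) x y z w =
  curv_form (riemann g p) (x *m B) (y *m B) (z *m B) (w *m B).
Proof.
move=> TC; pose Q := curv_form (riemann g p).
have frameE a b c d : riemann_in_frame g p B a b c d =
    Q (row a B) (row b B) (row c B) (row d B).
  rewrite /Q curv_formE /riemann_in_frame.
  by do 4 (apply: eq_bigr => ? _); rewrite !mxE.
have Q1 x' y' z' w' : Q (x' *m B) y' z' w' = \sum_a x' 0 a * Q (row a B) y' z' w'.
  rewrite mulmx_sum_row; elim/big_rec2: _ => [|a r v _ IH].
    by have := curv_form_lin (riemann g p) 1 0 0 y' z' w'; rewrite scale1r addr0 -/Q; lra.
  by rewrite /Q curv_form_lin -/Q IH.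
have Q2 x' y' z' w' : Q x' (y' *m B) z' w' = \sum_a y' 0 a * Q x' (row a B) z' w'.
  rewrite /Q (curv_skew12 TC) -/Q Q1 -sumrN; apply: eq_bigr => a _.
  by rewrite /Q [in RHS](curv_skew12 TC) mulrN.
have Q3 x' y' z' w' : Q x' y' (z' *m B) w' = \sum_a z' 0 a * Q x' y' (row a B) w'.
  rewrite /Q (curv_pair TC) -/Q Q1; apply: eq_bigr => a _.
  by rewrite /Q [in RHS](curv_pair TC).
have Q4 x' y' z' w' : Q x' y' z' (w' *m B) = \sum_a w' 0 a * Q x' y' z' (row a B).
  rewrite /Q (curv_pair TC) -/Q Q2; apply: eq_bigr => a _.
  by rewrite /Q [in RHS](curv_pair TC).
rewrite curv_formE -/Q Q1; apply: eq_bigr => a _.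
rewrite Q2 mulr_sumr; apply: eq_bigr => b _; rewrite Q3 !mulr_sumr; apply: eq_bigr => c _.
by rewrite Q4 !mulr_sumr; apply: eq_bigr => d _; rewrite frameE; ring.
Qed.

Lemma posdef_unit (G : 'M[R]_n) : (forall v, v != 0 -> 0 < gram G v v) -> G \in unitmx.
Proof.
move=> Gpos; rewrite -row_free_unit -kermx_eq0; apply/rowV0P => v /sub_kermxP vG.
by apply/eqP/contraT => /Gpos; rewrite /gram vG mul0mx mxE ltxx.
Qed.

Lemma orthonormal_frame_exists (G : 'M[R]_n) : G^T = G ->
  (forall v, v != 0 -> 0 < gram G v v) -> exists B : 'M[R]_n, B *m G *m B^T = 1%:M.
Proof.
move=> Gsym Gpos.
have gramD x y z : gram G (x + y) z = gram G x z + gram G y z.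
  by rewrite /gram !mulmxDl mxE.
have gramZ a x z : gram G (a *: x) z = a * gram G x z.
  by rewrite /gram -!scalemxAl mxE.
have gramC x y : gram G x y = gram G y x.
  by rewrite /gram -{1}Gsym -{1}(trmxK x) -!trmx_mul mulmxA mxE.
have o0 : orthonormal_seq (gram G) [::] by [].
have [t [ot _ tspan]] := orthonormal_completion gramD gramZ gramC Gpos
  (fun _ _ _ (_ : True) (_ : True) => I) o0 (fun _ _ => I).
have := orthonormal_basis_size gramD gramZ gramC ot (fun x => tspan x I).
rewrite /dim /= mul1n => tn.
pose B : 'M[R]_n := \matrix_i t`_i; exists B; apply/matrixP => i j.
have -> : (B *m G *m B^T) i j = gram G (row i B) (row j B).
  by rewrite /gram -row_mul [LHS]mxE [RHS]mxE; apply: eq_bigr => k _; rewrite !mxE.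
by rewrite !rowK mxE (ot i j) ?tn.
Qed.

End TensorForm.

Section PointwiseFlat.
Variables (R : realType) (n : nat).
Local Notation E := 'rV[R]_n.
Variables (g : E -> 'M[R]_n) (U : set E) (J : 'M[R]_n).
Hypothesis U_open : open U.
Hypothesis g_smooth : forall a b, smooth_on U (fun x => g x a b).
Hypothesis g_sym : forall x, U x -> (g x)^T = g x.
Hypothesis g_pos : forall x v, U x -> v != 0 -> 0 < gram (g x) v v.
Hypothesis JJ : J *m J = - 1%:M.
Hypothesis JT : J^T = - J.
Hypothesis g_hermitian : forall x, U x -> J *m g x *m J^T = g x.
Hypothesis g_closed : forall x a b c, U x ->
  pderiv a (fun y => (J *m g y) b c) x + pderiv b (fun y => (J *m g y) c a) x
  + pderiv c (fun y => (J *m g y) a b) x = 0.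

Let g_unit x : U x -> g x \in unitmx.
Proof. by move=> Ux; apply: posdef_unit => v; exact: g_pos. Qed.

(** The Bianchi identity holds for the index raised by the metric; skewness in
    the last two arguments moves that index to the fourth place. *)
Lemma riemann_curvature_like x : U x -> curvature_like (curv_form (riemann g x)).
Proof.
move=> Ux.
have skew34 i j k l : riemann g x i j k l = - riemann g x i j l k.
  have /matrixP/(_ k l) := curvature_mx_skew U_open g_smooth g_sym g_unit i j Ux.
  by rewrite !riemannE [LHS]mxE [RHS]mxE.
apply: tensor_curvature_like => // i j k l.
  by rewrite !riemannE curvature_mxC mulNmx mxE.
rewrite (skew34 i) (skew34 j) (skew34 k) /riemann -!opprD -!big_split big1 ?oppr0 //= => s _.
by rewrite -!mulrDl (curv_endo_bianchi U_open g_sym _ _ _ _ Ux) mul0r.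
Qed.

Lemma curv_form_riemannJ p x y z w : U p ->
  curv_form (riemann g p) x y (z *m J) (w *m J) = curv_form (riemann g p) x y z w.
Proof.
move=> Up; rewrite !curv_form_riemann; apply: eq_bigr => i _; apply: eq_bigr => j _.
have KJ := curvature_mx_comm U_open g_smooth g_sym g_unit JJ JT g_hermitian g_closed i j Up.
suff -> : w *m J *m (curvature_mx g i j p *m g p) *m (z *m J)^T =
    w *m (curvature_mx g i j p *m g p) *m z^T by [].
rewrite trmx_mul !mulmxA -(mulmxA w) KJ -[X in _ *m X *m z^T](g_hermitian Up).
by rewrite !mulmxA.
Qed.

(** In an orthonormal frame B the complex structure becomes B J B^-1, which is
    orthogonal because the metric is Hermitian, and the components of the
    curvature form an algebraic Kaehler curvature tensor. *)
Lemma riemann_eq0_of_four_nonneg x : (4 <= n)%N -> U x ->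
  (forall B, orthonormal_frame g x B -> k_nonneg_curv_op2 4 (riemann_in_frame g x B)) ->
  forall a b c d, riemann g x a b c d = 0.
Proof.
move=> n4 Ux T4.
have [B gB] := orthonormal_frame_exists (g_sym Ux) (fun v => g_pos Ux).
have TC := riemann_curvature_like Ux.
have BBg : B^T *m B *m g x = 1%:M.
  by rewrite -mulmxA; exact: mulmx1C gB.
have gBB : g x *m B^T *m B = 1%:M by apply: mulmx1C; rewrite mulmxA.
(* g B^T is the inverse of B *)
pose JB := B *m J *m (g x *m B^T).
have JB_B (y : E) : y *m JB *m B = y *m B *m J.
  by rewrite /JB -!mulmxA (mulmxA (g x)) gBB mulmx1.
have FC : curvature_like (curv_form (riemann_in_frame g x B)).
  split=> [a y y' z w v|y z w v|y z w v|y z w v]; rewrite !curv_form_frame //.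
  - by rewrite mulmxDl -scalemxAl curv_form_lin.
  - exact: (curv_skew12 TC).
  - exact: (curv_skew34 TC).
  - exact: (curv_bianchi TC).
have frame0 : forall a b c d, riemann_in_frame g x B a b c d = 0.
  apply: (kahler_curv_op2_flat FC (J := JB)) => //.
  - rewrite /JB -!mulmxA (mulmxA B^T) (mulmxA (g x)) (mulmxA (g x)) gBB mul1mx.
    by rewrite (mulmxA J) JJ !mulNmx mul1mx mulmxN mulmxA gB.
  - rewrite /JB !trmx_mul trmxK (g_sym Ux) !mulmxA.
    rewrite -(mulmxA _ B^T B) -(mulmxA _ (B^T *m B)) BBg mulmx1.
    by rewrite -(mulmxA B) -(mulmxA B) g_hermitian.
  - by move=> y z w v; rewrite !curv_form_frame // !JB_B curv_form_riemannJ.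
  - exact: T4.
have form0 y z w v : curv_form (riemann g x) y z w v = 0.
  have uE (u : E) : u = u *m (g x *m B^T) *m B by rewrite -mulmxA gBB mulmx1.
  rewrite (uE y) (uE z) (uE w) (uE v) -curv_form_frame // curv_formE.
  by do 4 (apply: big1 => ? _); rewrite frame0 !mul0r.
by move=> a b c d; rewrite -curv_form_delta form0.
Qed.

End PointwiseFlat.

Section StandardComplexStructure.
Variables (R : realType) (m : nat).

Lemma stdJ_sqr : stdJ R m *m stdJ R m = - 1%:M.
Proof.
rewrite /stdJ mulmx_block !mul0mx !mulmx0 !mul1mx !add0r !addr0 mulmx1.
by rewrite (scalar_mx_block m m 1) opp_block_mx !oppr0.
Qed.

Lemma stdJ_tr : (stdJ R m)^T = - stdJ R m.
Proof.
by rewrite /stdJ tr_block_mx opp_block_mx !trmx0 linearN /= trmx1 !oppr0 opprK.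
Qed.

End StandardComplexStructure.

Theorem theorem1p9 (R : realType) (m : nat) (M : kahlerManifold R m)
    (hm : (2 <= m)%N) (h4 : k_nonneg_curvature_second_kind 4 M) : flat M.
Proof.
move=> p i dip.
have n4 : (4 <= m + m)%N by rewrite (leq_add hm hm).
pose U := chart (r:=M) i @` dom i.
apply: (@riemann_eq0_of_four_nonneg _ _ _ U (stdJ R m)) => //.
- exact: chart_open.
- exact: metric_smooth.
- by move=> _ [q diq <-]; exact: Defs.metric_sym.
- by move=> _ v [q diq <-]; exact: metric_pos.
- exact: stdJ_sqr.
- exact: stdJ_tr.
- move=> _ [q diq <-]; apply/matrixP => a b.
  have := metric_hermitian (delta_mx 0 a) (delta_mx 0 b) diq.
  have gram_delta (G : 'M[R]_(m + m)) :
      gram G (delta_mx 0 a) (delta_mx 0 b) = G a b.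
    by rewrite /gram -rowE trmx_delta -colE !mxE.
  by rewrite gram_delta => <-; rewrite -gram_delta /gram trmx_mul !mulmxA.
- by move=> _ a b c [q diq <-]; exact: fundamental_form_closed.
- by exists p.
- by move=> B; exact: h4.
Qed.
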